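(* Let $M^{3}(\varphi,\xi,\eta,g)$ be a $3$-dimensional Kenmotsu manifold. Suppose that $g$ represents an $\eta$-Ricci soliton with potential vector field $V$, i.e. there are real constants $\lambda,\mu$ such that $$\tfrac12\,\mathcal{L}_V g+\mathrm{Ric}+\lambda\,g+\mu\,\eta\otimes\eta=0 .$$ Then $g$ is of constant negative (sectional) curvature $-1$.
   Context: An almost contact structure on a smooth manifold $M^{2n+1}$ of dimension $2n+1$ is a triple $(\varphi,\xi,\eta)$, where $\varphi$ is a $(1,1)$-tensor, $\xi$ a vector field (the Reeb vector field) and $\eta$ a $1$-form with $\varphi^2=-I+\eta\otimes\xi$ and $\eta(\xi)=1$. A Riemannian metric $g$ is compatible if $g(\varphi X,\varphi Y)=g(X,Y)-\eta(X)\eta(Y)$ for all vector fields $X,Y$; then $M(\varphi,\xi,\eta,g)$ is an almost contact metric manifold. It is a Kenmotsu manifold if $(\nabla_X\varphi)Y=g(\varphi X,Y)\,\xi-\eta(Y)\,\varphi X$ for all vector fields $X,Y$, where $\nabla$ is the Levi-Civita connection of $g$. Here $\mathcal{L}_V$ is the Lie derivative along $V$, $\mathrm{Ric}$ the Ricci tensor of $g$, and $(\eta\otimes\eta)(X,Y)=\eta(X)\eta(Y)$. *)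

(* Defs.v *)
From HB Require Import structures.
From mathcomp Require Import all_boot all_order all_algebra.
From mathcomp Require Import all_classical all_reals all_analysis.
Import Order.TTheory GRing.Theory Num.Theory.
Import numFieldNormedType.Exports.

Set Implicit Arguments.
Unset Strict Implicit.
Unset Printing Implicit Defensive.

Local Open Scope classical_set_scope.
Local Open Scope ring_scope.

(* [U] is meant to be open. *)
Fixpoint Ck_on {R : realType} {n : nat} (k : nat) (U : set 'rV[R]_n)
    (f : 'rV[R]_n -> R) : Prop :=
  (forall x, U x -> {for x, continuous f}) /\
  match k with
  | 0%N => True
  | k'.+1 => forall i : 'I_n,
      (forall x, U x -> derivable f x (delta_mx 0 i)) /\
      Ck_on k' U (fun x => 'D_(delta_mx 0 i) f x)
  end.

Definition smooth_on {R : realType} {n : nat} (U : set 'rV[R]_n)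
    (f : 'rV[R]_n -> R) : Prop := forall k, Ck_on k U f.

(* [cmap] and [cinv] are total; they are meaningful only on [cdom] and on
   [cmap @` cdom] respectively. *)
Record chart_on (R : realType) (n : nat) (M : topologicalType) := Chart {
  cdom : set M ;
  cmap : M -> 'rV[R]_n ;
  cinv : 'rV[R]_n -> M ;
  cdom_open : open cdom ;
  cimg_open : open (cmap @` cdom) ;
  cmapK : forall q, cdom q -> cinv (cmap q) = q ;
  cmap_cont : {within cdom, continuous cmap} ;
  cinv_cont : {within cmap @` cdom, continuous cinv}
}.

(* A smooth n-manifold (without boundary), given by one chart [chart p] around
   each point p. Every smooth structure has such a subatlas, and the subatlas
   determines the structure. *)
Record manifold (R : realType) (n : nat) := Manifold {
  carrier :> topologicalType ;
  manifold_hausdorff : hausdorff_space carrier ;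
  manifold_countable : @second_countable carrier ;
  chart : carrier -> chart_on R n carrier ;
  chart_mem : forall p, cdom (chart p) p ;
  chart_compat : forall (p q : carrier) (j : 'I_n),
    smooth_on (cmap (chart p) @` (cdom (chart p) `&` cdom (chart q)))
              (fun x => cmap (chart q) (cinv (chart p) x) 0 j)
}.

Definition smooth_fun {R : realType} {n : nat} {M : manifold R n}
    (U : set M) (f : M -> R) : Prop :=
  forall q : M, smooth_on (cmap (chart q) @` (U `&` cdom (chart q)))
                          (f \o cinv (chart q)).

(* The tangent space at p is represented by 'rV[R]_n, a vector v standing for
   \sum_i v_i d/dx^i, with x^i the coordinates of the chart chosen at p; that
   is, for the derivation f |-> [tderiv p v f]. The sections below are not
   assumed to be smooth. *)
Definition tderiv {R : realType} {n : nat} {M : manifold R n}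
    (p : M) (v : 'rV[R]_n) (f : M -> R) : R :=
  'D_v (f \o cinv (chart p)) (cmap (chart p) p).

Definition vfield {R : realType} {n : nat} (M : manifold R n) : Type :=
  M -> 'rV[R]_n.
Definition oneform {R : realType} {n : nat} (M : manifold R n) : Type :=
  M -> 'cV[R]_n.
(* (1,1)-tensors; the matrices act on row vectors on the right *)
Definition endofield {R : realType} {n : nat} (M : manifold R n) : Type :=
  M -> 'M[R]_n.
Definition bilfield {R : realType} {n : nat} (M : manifold R n) : Type :=
  M -> 'M[R]_n.
Definition connection_op {R : realType} {n : nat} (M : manifold R n) : Type :=
  vfield M -> vfield M -> vfield M.

Definition vact {R : realType} {n : nat} {M : manifold R n}
    (X : vfield M) (f : M -> R) : M -> R := fun p => tderiv p (X p) f.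

Definition form_app {R : realType} {n : nat} {M : manifold R n}
    (w : oneform M) (X : vfield M) : M -> R := fun p => (X p *m w p) 0 0.

Definition endo_app {R : realType} {n : nat} {M : manifold R n}
    (A : endofield M) (X : vfield M) : vfield M := fun p => X p *m A p.

Definition bil_app {R : realType} {n : nat} {M : manifold R n}
    (b : bilfield M) (X Y : vfield M) : M -> R :=
  fun p => (X p *m b p *m (Y p)^T) 0 0.

Definition smooth_vfield {R : realType} {n : nat} {M : manifold R n}
    (U : set M) (X : vfield M) : Prop :=
  forall (W : set M) (f : M -> R),
    open W -> W `<=` U -> smooth_fun W f -> smooth_fun W (vact X f).

Definition smooth_form {R : realType} {n : nat} {M : manifold R n}
    (w : oneform M) : Prop :=
  forall (U : set M) (X : vfield M),
    open U -> smooth_vfield U X -> smooth_fun U (form_app w X).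

Definition smooth_endo {R : realType} {n : nat} {M : manifold R n}
    (A : endofield M) : Prop :=
  forall (U : set M) (X : vfield M),
    open U -> smooth_vfield U X -> smooth_vfield U (endo_app A X).

Definition smooth_bil {R : realType} {n : nat} {M : manifold R n}
    (b : bilfield M) : Prop :=
  forall (U : set M) (X Y : vfield M), open U ->
    smooth_vfield U X -> smooth_vfield U Y -> smooth_fun U (bil_app b X Y).

(* The i-th component at p is X(Y x^i) - Y(X x^i), with x^i the coordinates of
   the chart chosen at p. *)
Definition lie_bracket {R : realType} {n : nat} {M : manifold R n}
    (X Y : vfield M) : vfield M :=
  fun p => \row_(i < n)
    let x := fun q : M => cmap (chart p) q 0 i in
    vact X (vact Y x) p - vact Y (vact X x) p.

Definition riemannian {R : realType} {n : nat} {M : manifold R n}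
    (g : bilfield M) : Prop :=
  [/\ smooth_bil g,
      forall p, (g p)^T = g p
    & forall p (v : 'rV[R]_n), v != 0 -> 0 < (v *m g p *m v^T) 0 0].

(* A connection acts on vector fields defined on open sets: the axioms are
   required on every open U, for all fields smooth on U, and the values of
   [nabla X Y] on U depend only on X and Y on U. *)
Record affine_connection {R : realType} {n : nat} {M : manifold R n}
    (nabla : connection_op M) : Prop := AffineConnection {
  conn_smooth : forall (U : set M) (X Y : vfield M), open U ->
    smooth_vfield U X -> smooth_vfield U Y -> smooth_vfield U (nabla X Y) ;
  conn_local : forall (U : set M) (X X' Y Y' : vfield M), open U ->
    smooth_vfield U X -> smooth_vfield U Y ->
    {in U, X =1 X'} -> {in U, Y =1 Y'} -> {in U, nabla X Y =1 nabla X' Y'} ;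
  conn_linearl : forall (U : set M) (X X' Y : vfield M) (f : M -> R), open U ->
    smooth_vfield U X -> smooth_vfield U X' -> smooth_vfield U Y ->
    smooth_fun U f -> forall p, U p ->
    nabla (fun q => f q *: X q + X' q) Y p = f p *: nabla X Y p + nabla X' Y p ;
  conn_additive : forall (U : set M) (X Y Y' : vfield M), open U ->
    smooth_vfield U X -> smooth_vfield U Y -> smooth_vfield U Y' ->
    forall p, U p ->
    nabla X (fun q => Y q + Y' q) p = nabla X Y p + nabla X Y' p ;
  conn_leibniz : forall (U : set M) (X Y : vfield M) (f : M -> R), open U ->
    smooth_vfield U X -> smooth_vfield U Y -> smooth_fun U f ->
    forall p, U p ->
    nabla X (fun q => f q *: Y q) p = vact X f p *: Y p + f p *: nabla X Y p
}.

Definition torsion_free {R : realType} {n : nat} {M : manifold R n}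
    (nabla : connection_op M) : Prop :=
  forall (U : set M) (X Y : vfield M), open U ->
    smooth_vfield U X -> smooth_vfield U Y -> forall p, U p ->
    nabla X Y p - nabla Y X p = lie_bracket X Y p.

Definition metric_connection {R : realType} {n : nat} {M : manifold R n}
    (g : bilfield M) (nabla : connection_op M) : Prop :=
  forall (U : set M) (X Y Z : vfield M), open U ->
    smooth_vfield U X -> smooth_vfield U Y -> smooth_vfield U Z ->
    forall p, U p ->
    vact X (bil_app g Y Z) p
    = bil_app g (nabla X Y) Z p + bil_app g Y (nabla X Z) p.

Definition levi_civita {R : realType} {n : nat} {M : manifold R n}
    (g : bilfield M) (nabla : connection_op M) : Prop :=
  [/\ affine_connection nabla, torsion_free nabla & metric_connection g nabla].

Definition curvature {R : realType} {n : nat} {M : manifold R n}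
    (nabla : connection_op M) (X Y Z : vfield M) : vfield M :=
  fun p => nabla X (nabla Y Z) p - nabla Y (nabla X Z) p
           - nabla (lie_bracket X Y) Z p.

(* The coordinate field d/dx^i of the chart chosen at p, written at q in the
   chart chosen at q; meaningful for q in the domain of the former. Its value
   at p is the i-th basis vector. *)
Definition coord_field {R : realType} {n : nat} {M : manifold R n}
    (p : M) (i : 'I_n) : vfield M :=
  fun q => \row_(j < n)
    'D_(delta_mx 0 i) (fun x => cmap (chart q) (cinv (chart p) x) 0 j)
                      (cmap (chart p) q).

(* Ric(Y,Z) at p is the trace of v |-> R(v,Y)Z on the tangent space at p. *)
Definition ricci {R : realType} {n : nat} {M : manifold R n}
    (nabla : connection_op M) (Y Z : vfield M) : M -> R :=
  fun p => \tr (\matrix_(i < n, j < n)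
                  curvature nabla (coord_field p i) Y Z p 0 j).

Definition lie_deriv_bil {R : realType} {n : nat} {M : manifold R n}
    (V : vfield M) (b : bilfield M) (X Y : vfield M) : M -> R :=
  fun p => vact V (bil_app b X Y) p
           - bil_app b (lie_bracket V X) Y p - bil_app b X (lie_bracket V Y) p.

Definition sectional {R : realType} {n : nat} {M : manifold R n}
    (g : bilfield M) (nabla : connection_op M) (X Y : vfield M) : M -> R :=
  fun p => bil_app g (curvature nabla X Y Y) X p
           / (bil_app g X X p * bil_app g Y Y p - bil_app g X Y p ^+ 2).

Definition constant_curvature {R : realType} {n : nat} {M : manifold R n}
    (g : bilfield M) (nabla : connection_op M) (c : R) : Prop :=
  forall (U : set M) (X Y : vfield M), open U ->
    smooth_vfield U X -> smooth_vfield U Y -> forall p, U p ->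
    row_free (col_mx (X p) (Y p)) -> sectional g nabla X Y p = c.

Definition almost_contact {R : realType} {n : nat} {M : manifold R n}
    (phi : endofield M) (xi : vfield M) (eta : oneform M) : Prop :=
  [/\ smooth_endo phi, smooth_vfield setT xi, smooth_form eta,
      forall p (v : 'rV[R]_n),
        v *m phi p *m phi p = - v + (v *m eta p) 0 0 *: xi p
    & forall p, form_app eta xi p = 1].

Definition compatible_metric {R : realType} {n : nat} {M : manifold R n}
    (phi : endofield M) (eta : oneform M) (g : bilfield M) : Prop :=
  forall p (v w : 'rV[R]_n),
    ((v *m phi p) *m g p *m (w *m phi p)^T) 0 0
    = (v *m g p *m w^T) 0 0 - (v *m eta p) 0 0 * (w *m eta p) 0 0.

Definition almost_contact_metric {R : realType} {n : nat} {M : manifold R n}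
    (phi : endofield M) (xi : vfield M) (eta : oneform M)
    (g : bilfield M) : Prop :=
  [/\ almost_contact phi xi eta, riemannian g & compatible_metric phi eta g].

Definition nabla_endo {R : realType} {n : nat} {M : manifold R n}
    (nabla : connection_op M) (A : endofield M) (X Y : vfield M) : vfield M :=
  fun p => nabla X (endo_app A Y) p - endo_app A (nabla X Y) p.

(* [nabla] is meant to be the Levi-Civita connection of [g]. *)
Definition kenmotsu {R : realType} {n : nat} {M : manifold R n}
    (phi : endofield M) (xi : vfield M) (eta : oneform M) (g : bilfield M)
    (nabla : connection_op M) : Prop :=
  almost_contact_metric phi xi eta g /\
  forall (U : set M) (X Y : vfield M), open U ->
    smooth_vfield U X -> smooth_vfield U Y -> forall p, U p ->
    nabla_endo nabla phi X Y p
    = bil_app g (endo_app phi X) Y p *: xi p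
      - form_app eta Y p *: endo_app phi X p.

Definition eta_ricci_soliton {R : realType} {n : nat} {M : manifold R n}
    (eta : oneform M) (g : bilfield M) (nabla : connection_op M)
    (V : vfield M) (lambda mu : R) : Prop :=
  forall (U : set M) (X Y : vfield M), open U ->
    smooth_vfield U X -> smooth_vfield U Y -> forall p, U p ->
    2^-1 * lie_deriv_bil V g X Y p + ricci nabla X Y p
    + lambda * bil_app g X Y p + mu * (form_app eta X p * form_app eta Y p) = 0.

(* Main.v *)
From HB Require Import structures.
Require Import Defs.
From mathcomp Require Import all_boot all_order all_algebra.
From mathcomp Require Import all_classical all_reals all_analysis.
From mathcomp Require Import ring lra.
Import Order.TTheory GRing.Theory Num.Theory.
Import numFieldNormedType.Exports.

(** A 3-dimensional Kenmotsu manifold is locally a warped product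
    dt^2 + e^(2t) h over a surface with metric h, with xi = d/dt; the only
    curvature left undetermined by this shape is that of the horizontal planes,
    k - 1 with k = e^(-2t) K and K the Gauss curvature of h. The theorem says
    that k vanishes.

    Write V = V_H + f xi and grad_H f for the horizontal gradient. The equation
    of the soliton makes xi f constant, ties the xi-derivative of V_H to
    grad_H f, and gives the symmetric part of nabla V_H. Differentiating the
    latter along xi gives the horizontal Hessian of f, and once more that
    xi f = 0; what is left are three facts about the surface:
    - Hess f = -2k g_H, whose integrability condition is 2 dk = k df;
    - W = V_H - (1/2) grad_H f is conformal, with factor s = 2 - lambda - f;
    - the curvature varies along a conformal field by
      W(k) + 2 s k = - Delta s = -4k.
    Together they give k (W(f) + 4s + 8) = 0. Differentiating this twice
    yields k (P - 16k) df = 0 and k^2 (s - 2) df = 0 with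
    P = |df|^2, and a last differentiation k^4 = 0. The relation 2 dk = k df
    lets a power of k be carried through every differentiation (lemma
    annihilator_deriv), so nothing is divided by k or by df and the zeros of
    these functions need no discussion.

    No warped product splitting is constructed. In a local orthonormal frame
    (e1, e2, xi) the argument becomes a computation in the ring of smooth
    functions with the three derivations e1, e2, xi (warped_soliton_flat). The
    remaining work is to produce its hypotheses: the condition of Kenmotsu
    enters only through nabla_X xi = X - eta(X) xi (nabla_xi), which determines
    the connection of the frame up to the form om(X) = g(nabla_X e1, e2), the
    brackets of the frame, the whole curvature tensor (curvature_frame) and the
    Ricci tensor (ricci_frame) in terms of om and k. This rests on the calculus
    of vector fields as derivations, whose core is that the Lie bracket acts as
    a commutator (vact_lie_bracket). *)
Set Implicit Arguments.
Unset Strict Implicit.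
Unset Printing Implicit Defensive.

Local Open Scope classical_set_scope.
Local Open Scope ring_scope.

(** * Differentiability from partial derivatives *)

Section Line.
Context {R : realType} {V : normedModType R}.
Implicit Types (f : V -> R) (x v : V).

Lemma is_derive_line f x v (s : R) : derivable f (s *: v + x) v ->
  is_derive s 1 (fun t : R => f (t *: v + x)) ('D_v f (s *: v + x)).
Proof.
have E : (fun h : R => h^-1 *: (((fun t : R => f (t *: v + x)) \o shift s) (h *: 1)
     - f (s *: v + x))) =
   (fun h => h^-1 *: ((f \o shift (s *: v + x)) (h *: v) - f (s *: v + x))).
  apply/funext => h /=; congr (_ *: (f _ - _)).
  by rewrite [h *: 1]mulr1 scalerDl addrA.
by rewrite /derivable -E => dg; split => //; rewrite /derive -E.
Qed.

(** Locating the intermediate point by |s| <= |t| covers both signs of t. *)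
Lemma MVT_line f x v (t : R) :
  (forall s : R, `|s| <= `|t| -> derivable f (s *: v + x) v) ->
  exists2 s, `|s| <= `|t| & f (t *: v + x) - f x = t * 'D_v f (s *: v + x).
Proof.
move=> df.
have df' (s : R) : `|s| <= `|t| -> is_derive s 1 (fun t : R => f (t *: v + x))
     ('D_v f (s *: v + x)) by move=> /df; exact: is_derive_line.
have cont (a b : R) : (forall s : R, s \in `[a, b]%R -> `|s| <= `|t|) ->
    {within `[a, b], continuous (fun t : R => f (t *: v + x))}.
  move=> ab; apply: derivable_within_continuous => s /ab /df' ds.
  exact: ex_derive.
case: (leP 0 t) => t0.
  have ab (s : R) : s \in `[0, t]%R -> `|s| <= `|t|.
    by rewrite in_itv /= => /andP[s0 st]; rewrite !ger0_norm.
  have [||s] := @MVT_segment R (fun s => f (s *: v + x))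
    (fun s => 'D_v f (s *: v + x)) 0 t t0.
  - by move=> s /subset_itv_oo_cc sab; apply: df'; exact: ab.
  - exact: cont.
  - by move=> /ab hs; rewrite scale0r add0r subr0 mulrC => ->; exists s.
have ab (s : R) : s \in `[t, 0]%R -> `|s| <= `|t|.
  by rewrite in_itv /= => /andP[s0 st]; rewrite !ler0_norm ?lerN2 // ltW.
have [||s] := @MVT_segment R (fun s => f (s *: v + x))
  (fun s => 'D_v f (s *: v + x)) t 0 (ltW t0).
- by move=> s /subset_itv_oo_cc sab; apply: df'; exact: ab.
- exact: cont.
- move=> /ab hs; rewrite scale0r add0r sub0r => E; exists s => //.
  by rewrite -opprB E mulrN mulrC opprK.
Qed.

End Line.

Section Basis.
Context {R : realType} {n : nat}.
Implicit Types (h : 'rV[R]_n).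

Lemma norm_delta_le (i : 'I_n) : `|delta_mx 0 i : 'rV[R]_n| <= 1.
Proof.
rewrite [leLHS]/Num.Def.normr /= mx_normrE; apply: bigmax_le => //= j _.
by rewrite mxE; case: (_ && _); rewrite ?normr1 ?normr0.
Qed.

Lemma norm_coord_le h (i : 'I_n) : `|h 0 i| <= `|h|.
Proof.
rewrite [leRHS]/Num.Def.normr /= mx_normrE.
exact: (le_bigmax _ (fun k : 'I_1 * 'I_n => `|h k.1 k.2|) (0, i)).
Qed.
End Basis.

(** The explicit epsilon form of the remainder is the one that mean value
    estimates provide. *)
Lemma differentiable_increment {R : realType} {V W : normedModType R}
    (f : V -> W) (L : {linear V -> W}) (x : V) : continuous L ->
  (forall eps : R, 0 < eps ->
     \forall h \near (0 : V), `|f (h + x) - f x - L h| <= eps * `|h|) ->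
  differentiable f x.
Proof.
move=> Lcont H.
have key : f \o shift x = cst (f x) + L +o_ (0 : V) id.
  apply/eqaddoE/eqaddoP => eps eps0; near=> h.
  rewrite /= -![(_ + _ : _ -> _) _]/(_ + _) -![(- _ : _ -> _) _]/(- _) /=.
  by rewrite opprD addrA; near: h; exact: H.
have dE := diff_unique Lcont key.
by apply/diff_locallyP; rewrite dE; split.
Unshelve. all: by end_near. Qed.

Section Differentiable.
Context {R : realType} {n : nat}.
Implicit Types (f : 'rV[R]_n -> R) (U : set 'rV[R]_n).
Local Notation e i := (delta_mx 0 i : 'rV[R]_n).

Definition trunc_row (j : nat) (h : 'rV[R]_n) : 'rV[R]_n :=
  \row_(i < n) (if (i < j)%N then h 0 i else 0).

Lemma norm_trunc_row j h : `|trunc_row j h| <= `|h|.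
Proof.
rewrite [leLHS]/Num.Def.normr /= mx_normrE; apply: bigmax_le => //= -[i k] _ /=.
rewrite mxE; case: ifP => _; rewrite ?normr0 //; exact: norm_coord_le.
Qed.

Lemma trunc_rowS (j : 'I_n) h :
  trunc_row j.+1 h = h 0 j *: e j + trunc_row j h.
Proof.
apply/rowP => i; rewrite !mxE eqxx /= ltnS leq_eqVlt; case: (eqVneq i j) => [->|ij].
  by rewrite eqxx ltnn mulr1 addr0.
by rewrite (negPf ij : (val i == val j) = false) /= mulr0 add0r.
Qed.

Lemma trunc_row0 h : trunc_row 0 h = 0.
Proof. by apply/rowP => i; rewrite !mxE. Qed.

Lemma trunc_row_full h : trunc_row n h = h.
Proof. by apply/rowP => i; rewrite !mxE ltn_ord. Qed.

(** The coordinates are changed one at a time, and the mean value theorem is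
    applied to each of the j steps. *)
Lemma partial_increment f x (d eps : R) :
  (forall (i : 'I_n) y, `|y - x| < d -> derivable f y (e i)) ->
  (forall (i : 'I_n) y, `|y - x| < d -> `|'D_(e i) f y - 'D_(e i) f x| <= eps) ->
  forall h, `|h| < d / 2 -> forall j, (j <= n)%N ->
  `|f (trunc_row j h + x) - f x - \sum_(i < n | (i < j)%N) h 0 i * 'D_(e i) f x|
     <= j%:R * (eps * `|h|).
Proof.
move=> df cf h hd; elim=> [|j IH] jn.
  rewrite trunc_row0 add0r subrr big_pred0 ?subr0 ?normr0 ?mul0r //.
pose jo : 'I_n := Ordinal jn.
have hd1 (s : R) : `|s| <= `|h 0 jo| ->
    `|(s *: e jo + (trunc_row j h + x)) - x| < d.
  move=> sh; rewrite addrA addrK.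
  apply: le_lt_trans (ler_normD _ _) _; rewrite [ltRHS]splitr.
  apply: ler_ltD; last exact: le_lt_trans (norm_trunc_row _ _) hd.
  rewrite normrZ; apply: le_trans (ltW hd).
  apply: le_trans (norm_coord_le h jo); rewrite -[leRHS]mulr1.
  by apply: ler_pM => //; exact: norm_delta_le.
have [s sh E] : exists2 s : R, `|s| <= `|h 0 jo| &
    f (trunc_row j.+1 h + x) - f (trunc_row j h + x) =
    h 0 jo * 'D_(e jo) f (s *: e jo + (trunc_row j h + x)).
  have [|s sh E] := @MVT_line R _ f (trunc_row j h + x) (e jo) (h 0 jo).
    by move=> s /hd1; exact: df.
  by exists s => //; rewrite -E addrA -trunc_rowS.
rewrite (bigD1 jo) //= (eq_bigl (fun i : 'I_n => (i < j)%N)); last first.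
  move=> i; rewrite ltnS (leq_eqVlt i) andb_orl.
  rewrite -(inj_eq val_inj) /= andbN /=; apply/andb_idr.
  by move=> /ltn_eqF ->.
set S := \sum_(i < n | _) _ in IH *.
have -> : f (trunc_row j.+1 h + x) - f x - (h 0 jo * 'D_(e jo) f x + S) =
  (f (trunc_row j h + x) - f x - S) +
  h 0 jo * ('D_(e jo) f (s *: e jo + (trunc_row j h + x)) - 'D_(e jo) f x).
  by rewrite mulrBr -E; ring.
apply: le_trans (ler_normD _ _) _; rewrite -natr1 mulrDl mul1r; apply: lerD.
  by apply: IH; exact: ltnW.
rewrite normrM mulrC; apply: ler_pM => //; last exact: norm_coord_le.
by apply: cf; exact: hd1.
Qed.

(** The predicate Ck_on only controls partial derivatives; total
    differentiability is what makes directional derivatives linear in the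
    direction and gives the chain rule. *)
Lemma C1_differentiable f U x : open U -> U x ->
  (forall (i : 'I_n) y, U y -> derivable f y (e i)) ->
  (forall i : 'I_n, {for x, continuous (fun y => 'D_(e i) f y)}) ->
  differentiable f x.
Proof.
move=> oU Ux df cf.
pose L (h : 'rV[R]_n) : R := \sum_(i < n) h 0 i * 'D_(e i) f x.
have Llin : linear L.
  move=> a u v; rewrite /L scaler_sumr -big_split /=; apply: eq_bigr => i _.
  by rewrite !mxE [_ *: _]mulrA mulrDl.
pose LM := GRing.isLinear.Build _ _ _ _ _ Llin.
pose LL : {linear 'rV[R]_n -> R} := HB.pack L LM.
have Lcont : continuous LL.
  move=> h; apply: differentiable_continuous.
  rewrite (_ : (LL : _ -> _) =
     \sum_(i < n) (fun h : 'rV[R]_n => h 0 i * 'D_(e i) f x)); last first.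
    by apply/funext => u; rewrite /= /L fct_sumE.
  apply: differentiable_sum => i; apply: differentiableM => //.
  exact: differentiable_coord.
apply: (differentiable_increment Lcont) => _/posnumP[eps].
  have eps0 : 0 < eps%:num / n.+1%:R by rewrite divr_gt0.
  have [d d0 hd] : exists2 d : R, 0 < d & forall (i : 'I_n) y, `|y - x| < d ->
     U y /\ `|'D_(e i) f y - 'D_(e i) f x| <= eps%:num / n.+1%:R.
    have : \forall y \near x, U y /\
       forall i : 'I_n, `|'D_(e i) f y - 'D_(e i) f x| <= eps%:num / n.+1%:R.
      near=> y; split; first by near: y; exact: open_nbhs_nbhs.
      near: y; apply: filter_forall => i; near=> y; rewrite distrC.
      by near: y; move/cvgrPdist_le: (cf i) => /(_ _ eps0).
    move=> /nbhs_ballP[d d0 hd]; exists d => // i y yd.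
    by have [|? ?] := hd y; [rewrite -ball_normE /= distrC|split].
  near=> h.
  have hd2 : `|h| < d / 2.
    near: h; apply/nbhs_ballP; exists (d / 2); first by rewrite /= divr_gt0.
    by move=> h; rewrite -ball_normE /= sub0r normrN.
  have H1 (i : 'I_n) y : `|y - x| < d -> derivable f y (e i) by move=> /(hd i)[? _]; exact: df.
  have H2 (i : 'I_n) y : `|y - x| < d -> `|'D_(e i) f y - 'D_(e i) f x| <= eps%:num / n.+1%:R.
    by move=> /(hd i)[].
  have := partial_increment H1 H2 hd2 (leqnn n).
  rewrite trunc_row_full (eq_bigl xpredT); last by move=> i; rewrite ltn_ord.
  move=> /le_trans; apply.
  rewrite mulrA ler_wpM2r // mulrCA -[leRHS]mulr1 ler_wpM2l //.
  by rewrite ler_pdivrMr // mul1r ler_nat.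
Unshelve. all: by end_near. Qed.

End Differentiable.

(** * Functions of class C^k on open sets *)

Section Ck.
Context {R : realType} {n : nat}.
Implicit Types (f g : 'rV[R]_n -> R) (U : set 'rV[R]_n) (k : nat).
Local Notation e i := (delta_mx 0 i : 'rV[R]_n).

Lemma Ck_on_continuous k U f x : Ck_on k U f -> U x -> {for x, continuous f}.
Proof. by case: k => [|k] [H _] /H. Qed.

Lemma Ck_onW k U f : Ck_on k.+1 U f -> Ck_on k U f.
Proof.
elim: k f => [|k IH] f [c H]; split => // i; have [d Hk] := H i.
by split => //; exact: IH.
Qed.

Lemma Ck_onS k U U' f : U' `<=` U -> Ck_on k U f -> Ck_on k U' f.
Proof.
move=> UU'; elim: k f => [|k IH] f [c H]; split => //.
- by move=> x /UU'; exact: c.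
- by move=> x /UU'; exact: c.
- by move=> i; have [d Hk] := H i; split; [move=> x /UU'; exact: d|exact: IH].
Qed.

Lemma eq_Ck_on k U f g : open U -> (forall x, U x -> f x = g x) ->
  Ck_on k U f -> Ck_on k U g.
Proof.
move=> oU; have N f1 g1 x : (forall x, U x -> f1 x = g1 x) -> U x ->
    \forall y \near x, f1 y = g1 y.
  by move=> fg Ux; near=> y; apply: fg; near: y; exact: open_nbhs_nbhs.
have C f1 g1 x : (forall x, U x -> f1 x = g1 x) -> U x ->
    {for x, continuous f1} -> {for x, continuous g1}.
  move=> fg Ux cf; have E := fg _ Ux.
  rewrite /prop_for /continuous_at -E; apply: cvg_trans cf.
  by apply: (@near_eq_cvg _ _ (nbhs x) _ f1 g1); exact: N.
elim: k f g => [|k IH] f g fg [c H]; split => //.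
- by move=> x Ux; apply: (C f) => //; exact: c.
- by move=> x Ux; apply: (C f) => //; exact: c.
- move=> i; have [d Hk] := H i; split.
  + move=> x Ux; apply: (near_eq_derivable (f := f)); last exact: d.
    exact: N.
  + apply: IH Hk => x Ux; apply: near_eq_derive; exact: N.
Unshelve. all: by end_near. Qed.

Lemma Ck_on_differentiable k U f x : open U -> U x -> Ck_on k.+1 U f ->
  differentiable f x.
Proof.
move=> oU Ux [_ H]; apply: (@C1_differentiable _ _ f U) => // i.
  by move=> y Uy; have [d _] := H i; exact: d.
by have [_ Hk] := H i; exact: Ck_on_continuous Hk Ux.
Qed.

Lemma derive_coord f x v : differentiable f x ->
  'D_v f x = \sum_(i < n) v 0 i * 'D_(e i) f x.
Proof.
move=> df; rewrite deriveE // {1}(row_sum_delta v) linear_sum /=.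
by apply: eq_bigr => i _; rewrite linearZ /= deriveE.
Qed.

Lemma deriveDv f x u v : differentiable f x ->
  'D_(u + v) f x = 'D_u f x + 'D_v f x.
Proof. by move=> df; rewrite !deriveE // linearD. Qed.

Lemma deriveZv f x (a : R) v : differentiable f x ->
  'D_(a *: v) f x = a * 'D_v f x.
Proof. by move=> df; rewrite !deriveE // linearZ. Qed.

Lemma Ck_on_cst k U (a : R) : Ck_on k U (fun _ => a).
Proof.
elim: k a => [|k IH] a; (split; first by move=> x _; exact: cst_continuous) => // i.
split; first by move=> x _; exact: derivable_cst.
have -> : 'D_(e i) (fun _ : 'rV[R]_n => a) = fun=> 0; last exact: IH.
by apply/funext => x; rewrite derive_cst.
Qed.

Lemma Ck_on_add k U f g : open U -> Ck_on k U f -> Ck_on k U g ->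
  Ck_on k U (fun x => f x + g x).
Proof.
move=> oU; elim: k f g => [|k IH] f g [cf Hf] [cg Hg];
    (split; first by move=> x Ux;
      exact: (continuousD (cf x Ux) (cg x Ux))) => // i.
have [df Hf'] := Hf i; have [dg Hg'] := Hg i; split.
  by move=> x Ux; apply: derivableD; [exact: df|exact: dg].
apply: eq_Ck_on (IH _ _ Hf' Hg') => // x Ux; rewrite -deriveD //.
  exact: df.
exact: dg.
Qed.

Lemma Ck_on_mul k U f g : open U -> Ck_on k U f -> Ck_on k U g ->
  Ck_on k U (fun x => f x * g x).
Proof.
move=> oU; elim: k f g => [|k IH] f g Hf Hg; have [cf Hf1] := Hf;
    have [cg Hg1] := Hg;
    (split; first by move=> x Ux;
      exact: (continuousM (cf x Ux) (cg x Ux))) => // i.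
have [df Hf'] := Hf1 i; have [dg Hg'] := Hg1 i; split.
  by move=> x Ux; apply: derivableM; [exact: df|exact: dg].
have := Ck_on_add oU (IH _ _ (Ck_onW Hf) Hg') (IH _ _ (Ck_onW Hg) Hf').
apply: eq_Ck_on => // x Ux; rewrite -[RHS]/('D_(e i) (f * g) x) deriveM //.
  exact: df.
exact: dg.
Qed.

Lemma Ck_on_sum k U (I : Type) (r : seq I) (F : I -> 'rV[R]_n -> R) : open U ->
  (forall i, Ck_on k U (F i)) -> Ck_on k U (fun x => \sum_(i <- r) F i x).
Proof.
move=> oU H; elim: r => [|i r IH].
  rewrite (_ : (fun x => _) = fun=> 0); first exact: Ck_on_cst.
  by apply/funext => x; rewrite big_nil.
rewrite (_ : (fun x => _) = fun x => F i x + \sum_(i <- r) F i x).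
  exact: Ck_on_add.
by apply/funext => x; rewrite big_cons.
Qed.

Lemma Ck_on_inv k U f : open U -> (forall x, U x -> f x != 0) ->
  Ck_on k U f -> Ck_on k U (fun x => (f x)^-1).
Proof.
move=> oU f0; elim: k f f0 => [|k IH] f f0 Hf; have [cf Hf1] := Hf;
    (split; first by move=> x Ux;
      exact: (continuousV (f0 x Ux) (cf x Ux))) => // i.
have [df Hf'] := Hf1 i; split.
  by move=> x Ux; apply: derivableV; [exact: f0|exact: df].
have If := IH _ f0 (Ck_onW Hf).
have := Ck_on_mul oU (Ck_on_mul oU (Ck_on_cst k U (-1)) (Ck_on_mul oU If If)) Hf'.
apply: eq_Ck_on => // x Ux; rewrite deriveV ?f0 //; last exact: df.
by rewrite mulN1r [RHS]/GRing.scale /= expr2 invfM.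
Qed.

Lemma Ck_on_sqrt k U f : open U -> (forall x, U x -> 0 < f x) ->
  (forall k, Ck_on k U f) -> Ck_on k U (fun x => Num.sqrt (f x)).
Proof.
move=> oU f0 Hf; elim: k => [|k IH];
    (split; first by move=> x Ux; apply: continuous_comp;
      [exact: Ck_on_continuous (Hf 0%N) Ux|exact: sqrt_continuous]) => // i.
have ds x : U x -> differentiable (@Num.sqrt R) (f x).
  by move=> /f0 fx; apply/derivable1_diffP; have [] := is_derive1_sqrt fx.
have df x : U x -> differentiable f x.
  by move=> Ux; exact: Ck_on_differentiable (Hf 1%N).
have dsf x : U x -> differentiable (@Num.sqrt R \o f) x.
  by move=> Ux; exact: (differentiable_comp (df x Ux) (ds x Ux)).
split; first by move=> x Ux; exact: (diff_derivable (dsf x Ux)).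
have I2 : Ck_on k U (fun x => (2 * Num.sqrt (f x))^-1).
  apply: Ck_on_inv => //.
    by move=> x /f0 fx; rewrite mulf_neq0 // sqrtr_eq0 -ltNge.
  by apply: Ck_on_mul => //; exact: Ck_on_cst.
have [_ Hf1] := Hf k.+1; have [_ Hf'] := Hf1 i.
have := Ck_on_mul oU Hf' I2.
apply: eq_Ck_on => // x Ux.
rewrite -[RHS]/('D_(e i) (@Num.sqrt R \o f) x) [RHS]deriveE; last exact: dsf.
rewrite diff_comp /=; [|exact: df|exact: ds].
rewrite -[X in 'd (@Num.sqrt R) _ X]deriveE; last exact: df.
set a := 'D_(e i) f x; rewrite -[in RHS](mulr1 a) [RHS]linearZ /= -deriveE.
  by rewrite derive_sqrt // f0.
exact: ds.
Qed.

End Ck.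

Section Chain.
Context {R : realType} {n m : nat}.
Implicit Types (F : 'rV[R]_m -> R) (G : 'rV[R]_n -> 'rV[R]_m).

Lemma differentiable_row G x :
  (forall j, differentiable (fun y => G y 0 j) x) -> differentiable G x.
Proof.
move=> dG; rewrite (_ : G =
    \sum_(j < m) (fun y => G y 0 j *: (delta_mx 0 j : 'rV[R]_m))); last first.
  by apply/funext => y; rewrite fct_sumE -row_sum_delta.
by apply: differentiable_sum => j; exact: differentiableZl.
Qed.

Lemma derive_chain F G x v :
  (forall j, differentiable (fun y => G y 0 j) x) -> differentiable F (G x) ->
  differentiable (F \o G) x /\
  'D_v (F \o G) x = \sum_(j < m) 'D_v (fun y => G y 0 j) x
                                 * 'D_(delta_mx 0 j) F (G x).
Proof.
move=> dGj dF; have dG := differentiable_row dGj.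
split; first exact: differentiable_comp.
rewrite deriveE; last exact: differentiable_comp.
rewrite diff_comp //= -[in LHS]deriveE // -deriveE // derive_coord //.
apply: eq_bigr => j _; rewrite derive_mx; last exact: diff_derivable.
by rewrite mxE.
Qed.

(** By the chain rule the partial derivatives of F o G are combinations of those
    of F at G, which have one order less; as G is smooth to all orders, the
    induction only concerns F. *)
Lemma Ck_on_comp k (U : set 'rV[R]_n) (W : set 'rV[R]_m) F G :
  open U -> open W -> (forall x, U x -> W (G x)) ->
  Ck_on k W F -> (forall j, smooth_on U (fun x => G x 0 j)) ->
  Ck_on k U (F \o G).
Proof.
move=> oU oW UW + sG; have dG x j : U x -> differentiable (fun y => G y 0 j) x.
  by move=> Ux; exact: Ck_on_differentiable (sG j 1%N).
have cG x : U x -> {for x, continuous G}.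
  move=> Ux; apply: differentiable_continuous; apply: differentiable_row => j.
  exact: dG.
elim: k F => [|k IH] F HF; have [cF HF1] := HF;
  (split; first by move=> x Ux; apply: continuous_comp;
     [exact: cG|by apply: cF; exact: UW]) => // i.
have dF x : U x -> differentiable F (G x).
  by move=> /UW WG; exact: Ck_on_differentiable HF.
split.
  move=> x Ux; apply: diff_derivable.
  by have [] := derive_chain (delta_mx 0 i) (fun j => dG x j Ux) (dF x Ux).
pose H j x := 'D_(delta_mx 0 i) (fun y => G y 0 j) x
              * 'D_(delta_mx 0 j) F (G x).
suff : Ck_on k U (fun x => \sum_(j < m) H j x).
  apply: eq_Ck_on => // x Ux.
  by have [_ ->] := derive_chain (delta_mx 0 i) (fun j => dG x j Ux) (dF x Ux).
apply: Ck_on_sum => // j; apply: Ck_on_mul => //.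
  by have [_ /(_ i)[]] := sG j k.+1.
by have [_ Hj] := HF1 j; exact: (IH _ Hj).
Qed.

End Chain.

(** * Symmetry of second derivatives *)

Section Schwarz.
Context {R : realType} {V : normedModType R}.
Implicit Types (f : V -> R) (x u v : V).

Lemma is_derive_shift_line f x w u : derivable f (w + x) u ->
  is_derive x u (fun y => f (w + y)) ('D_u f (w + x)).
Proof.
have E : (fun h : R => h^-1 *: (((fun y => f (w + y)) \o shift x) (h *: u)
     - f (w + x))) =
   (fun h => h^-1 *: ((f \o shift (w + x)) (h *: u) - f (w + x))).
  by apply/funext => h /=; rewrite addrCA.
by rewrite /derivable -E => dg; split => //; rewrite /derive -E.
Qed.

(** The second difference of f is the u-increment of a v-increment: the mean
    value theorem applies first to the v-increment as a function along u, then
    to the u-derivative of f along v. *)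
Lemma second_difference f x u v (h : R) :
  (forall s t : R, `|s| <= `|h| -> `|t| <= `|h| ->
     derivable f (t *: v + (s *: u + x)) u /\
     derivable ('D_u f) (t *: v + (s *: u + x)) v) ->
  exists s t : R, [/\ `|s| <= `|h|, `|t| <= `|h| &
    f (h *: v + (h *: u + x)) - f (h *: u + x) - (f (h *: v + x) - f x)
    = h * (h * 'D_v ('D_u f) (t *: v + (s *: u + x)))].
Proof.
move=> df; pose phi y := f (h *: v + y) - f y.
have dphi (s : R) : `|s| <= `|h| -> is_derive (s *: u + x) u phi
    ('D_u f (h *: v + (s *: u + x)) - 'D_u f (s *: u + x)).
  move=> sh; apply: is_deriveB.
    exact: (is_derive_shift_line (df s h sh (lexx _)).1).
  apply: derivableP; have [] := df s 0 sh; first by rewrite normr0.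
  by rewrite scale0r add0r.
have [|s sh E1] := @MVT_line R _ phi x u h.
  by move=> s /dphi[].
have [|t th E2] := @MVT_line R _ ('D_u f) (s *: u + x) v h.
  by move=> t th; have [] := df s t sh th.
exists s, t; split => //; rewrite -E2.
by rewrite -[LHS]/(phi (h *: u + x) - phi x) E1 (@derive_val _ _ _ _ _ _ _ (dphi s sh)).
Qed.

Let second_difference_inj (h A1 A2 a b c d : R) : 0 < h ->
  a - b - (c - d) = h * (h * A1) -> a - c - (b - d) = h * (h * A2) -> A1 = A2.
Proof.
move=> h0 E1 E2; have hn0 : h != 0 by rewrite gt_eqF.
by apply: (mulfI hn0); apply: (mulfI hn0); rewrite -E1 -E2; ring.
Qed.

Let dist_common (a b c d e1 e2 : R) :
  `|a - b| <= e1 -> `|c - d| <= e2 -> b = d -> `|a - c| <= e1 + e2.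
Proof.
move=> H1 H2 E; apply: le_trans (lerD H1 H2); rewrite E (distrC c d).
by apply: le_trans (ler_normD _ _); rewrite addrA subrK.
Qed.

(** The second difference does not depend on the order of u and v, so the two
    mixed derivatives agree at some points arbitrarily close to x. *)
Lemma derive_swap f x u v (A : set V) : open A -> A x ->
  (forall y, A y -> [/\ derivable f y u, derivable f y v,
      derivable ('D_u f) y v & derivable ('D_v f) y u]) ->
  {for x, continuous ('D_v ('D_u f))} -> {for x, continuous ('D_u ('D_v f))} ->
  'D_v ('D_u f) x = 'D_u ('D_v f) x.
Proof.
move=> oA Ax df c1 c2; apply/eqP; rewrite -subr_eq0 -normr_le0.
apply/ler_addgt0Pr => eps eps0; rewrite add0r.
have e20 : 0 < eps / 2 by rewrite divr_gt0.
have N1 : \forall y \near x, `|'D_v ('D_u f) x - 'D_v ('D_u f) y| <= eps / 2.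
  by move/cvgrPdist_le : c1 => /(_ _ e20).
have N2 : \forall y \near x, `|'D_u ('D_v f) x - 'D_u ('D_v f) y| <= eps / 2.
  by move/cvgrPdist_le : c2 => /(_ _ e20).
have N0 : \forall y \near x, A y by exact: open_nbhs_nbhs.
have : \forall y \near x, A y /\
    (`|'D_v ('D_u f) x - 'D_v ('D_u f) y| <= eps / 2 /\
     `|'D_u ('D_v f) x - 'D_u ('D_v f) y| <= eps / 2).
  exact: filterI N0 (filterI N1 N2).
move=> /nbhs_ballP[d d0 hd].
have uv0 : 0 < `|u| + `|v| + 1 by rewrite ltr_wpDl // addr_ge0.
pose h := d / (`|u| + `|v| + 1); have h0 : 0 < h by rewrite divr_gt0.
have inb (s t : R) : `|s| <= `|h| -> `|t| <= `|h| ->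
    ball x d (t *: v + (s *: u + x)).
  move=> sh th; rewrite -ball_normE /= distrC addrA addrK.
  apply: le_lt_trans (ler_normD _ _) _; rewrite !normrZ.
  apply: (@le_lt_trans _ _ (h * (`|u| + `|v|))).
    rewrite addrC mulrDr -{1 2}(gtr0_norm h0).
    by apply: lerD; apply: ler_wpM2r.
  by rewrite /h mulrAC ltr_pdivrMr // ltr_pM2l // ltrDl.
have [|s [t [sh th E1]]] := @second_difference f x u v h.
  by move=> s t sh th; have [/df[]] := hd _ (inb s t sh th).
have sw (a b : R) : b *: u + (a *: v + x) = a *: v + (b *: u + x).
  by rewrite addrCA.
have [|s' [t' [sh' th' E2]]] := @second_difference f x v u h.
  by move=> s' t' sh' th'; rewrite sw; have [/df[]] := hd _ (inb t' s' th' sh').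
have inb' : ball x d (t' *: u + (s' *: v + x)) by rewrite sw; exact: inb.
rewrite (sw h h) in E2; have E := second_difference_inj h0 E1 E2.
have [_ [H1 _]] := hd _ (inb s t sh th).
have [_ [_ H2]] := hd _ inb'.
rewrite [leRHS]splitr; apply: dist_common H1 H2 E.
Unshelve. all: by end_near. Qed.

End Schwarz.

(** * Smooth functions and vector fields on a manifold *)

Section Manifold.
Context {R : realType} {n : nat} {M : manifold R n}.
Implicit Types (p q r : M) (U W : set M) (f g : M -> R) (X Y Z : vfield M).
Local Notation e i := (delta_mx 0 i : 'rV[R]_n).

Definition xcoord p (j : 'I_n) : M -> R := fun q => cmap (chart p) q 0 j.

Definition chart_img p U := cmap (chart p) @` (U `&` cdom (chart p)).

Definition pderiv p (i : 'I_n) f : M -> R :=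
  fun q => 'D_(e i) (f \o cinv (chart p)) (cmap (chart p) q).

Lemma chart_imgP p U x : chart_img p U x ->
  [/\ U (cinv (chart p) x), cdom (chart p) (cinv (chart p) x) &
      cmap (chart p) (cinv (chart p) x) = x].
Proof. by case=> q [Uq dq] <-; rewrite cmapK. Qed.

Lemma chart_img_mem p U q : U q -> cdom (chart p) q ->
  chart_img p U (cmap (chart p) q).
Proof. by move=> Uq dq; exists q. Qed.

Lemma chart_imgS p U W : W `<=` U -> chart_img p W `<=` chart_img p U.
Proof. by move=> WU x [q [Wq dq] <-]; exists q => //; split=> //; exact: WU. Qed.

Lemma chart_img_open p U : open U -> open (chart_img p U).
Proof.
move=> oU; rewrite openE => x xU.
have [Ux dx xE] := chart_imgP xU; rewrite /interior.
have oI := @cimg_open _ _ _ (chart p).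
have Ix : (cmap (chart p) @` cdom (chart p)) x by exists (cinv (chart p) x).
have ci : {for x, continuous (cinv (chart p))}.
  have := @cinv_cont _ _ _ (chart p).
  by rewrite continuous_open_subspace //; apply; rewrite inE.
have N1 : \forall y \near x, U (cinv (chart p) y).
  by apply: ci; exact: open_nbhs_nbhs.
have N2 : \forall y \near x, (cmap (chart p) @` cdom (chart p)) y.
  exact: open_nbhs_nbhs.
apply: filterS2 N1 N2 => y Uy [q dq qE].
by exists q => //; split => //; rewrite -(cmapK dq) qE.
Qed.

Lemma smooth_funS U W f : W `<=` U -> smooth_fun U f -> smooth_fun W f.
Proof.
move=> WU sf q k; apply: Ck_onS (sf q k); exact: (@chart_imgS q).
Qed.

Lemma eq_smooth_fun U f g : open U -> (forall q, U q -> f q = g q) ->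
  smooth_fun U f -> smooth_fun U g.
Proof.
move=> oU fg sf q k; apply: eq_Ck_on (sf q k).
  exact: (chart_img_open (p := q)).
by move=> x /(@chart_imgP q) [Ux _ _]; exact: fg.
Qed.

Lemma smooth_fun_cst U (a : R) : smooth_fun U (fun _ => a).
Proof. by move=> q k; exact: Ck_on_cst. Qed.

Lemma smooth_funD U f g : open U -> smooth_fun U f -> smooth_fun U g ->
  smooth_fun U (fun q => f q + g q).
Proof.
by move=> oU sf sg q k; apply: Ck_on_add (sf q k) (sg q k); exact: (@chart_img_open q).
Qed.

Lemma smooth_funM U f g : open U -> smooth_fun U f -> smooth_fun U g ->
  smooth_fun U (fun q => f q * g q).
Proof.
by move=> oU sf sg q k; apply: Ck_on_mul (sf q k) (sg q k); exact: (@chart_img_open q).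
Qed.

Lemma smooth_funN U f : open U -> smooth_fun U f ->
  smooth_fun U (fun q => - f q).
Proof.
move=> oU sf; apply: eq_smooth_fun (smooth_funM oU (smooth_fun_cst U (-1)) sf) => //.
by move=> q _; rewrite mulN1r.
Qed.

Lemma smooth_funB U f g : open U -> smooth_fun U f -> smooth_fun U g ->
  smooth_fun U (fun q => f q - g q).
Proof. by move=> oU sf sg; apply: smooth_funD => //; exact: smooth_funN. Qed.

Lemma smooth_fun_sum U (I : Type) (s : seq I) (F : I -> M -> R) : open U ->
  (forall i, smooth_fun U (F i)) -> smooth_fun U (fun q => \sum_(i <- s) F i q).
Proof.
move=> oU sF q k; apply: (@Ck_on_sum _ _ k _ _ s (fun i => F i \o cinv (chart q))).
  exact: (@chart_img_open q).
by move=> i; exact: sF.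
Qed.

Lemma smooth_fun_inv_sqrt U f : open U -> (forall q, U q -> 0 < f q) ->
  smooth_fun U f -> smooth_fun U (fun q => (Num.sqrt (f q))^-1).
Proof.
move=> oU f0 sf q k; have oI := chart_img_open (p := q) oU.
have f0' x : chart_img q U x -> 0 < f (cinv (chart q) x).
  by move=> /chart_imgP[Ux _ _]; exact: f0.
apply: Ck_on_inv => //.
  by move=> x /f0' fx; rewrite sqrtr_eq0 -ltNge.
by apply: Ck_on_sqrt => // k'; exact: sf.
Qed.

Lemma smooth_fun_xcoord p j : smooth_fun (cdom (chart p)) (xcoord p j).
Proof.
by move=> q; rewrite [X in smooth_on (_ @` X)]setIC; exact: chart_compat.
Qed.

Lemma smooth_fun_differentiable U f p q : open U -> smooth_fun U f -> U q ->
  cdom (chart p) q -> differentiable (f \o cinv (chart p)) (cmap (chart p) q).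
Proof.
move=> oU sf Uq dq; apply: (Ck_on_differentiable (chart_img_open oU)) (sf p 1%N).
exact: chart_img_mem.
Qed.

Lemma tderiv_local U f g p v : open U -> U p ->
  (forall q, U q -> f q = g q) -> tderiv p v f = tderiv p v g.
Proof.
move=> oU Up fg; apply: near_eq_derive.
have : \forall x \near cmap (chart p) p, chart_img p U x.
  apply: open_nbhs_nbhs; split; first exact: chart_img_open.
  exact: chart_img_mem (chart_mem p).
by apply: filterS => x /chart_imgP[Ux _ _] /=; exact: fg.
Qed.

(** A vector at q is read in the chart chosen at q, so the value of a field on f
    involves a different chart at each point. The chain rule rewrites it in a
    single chart, which is needed before it can be differentiated again. *)
Lemma chart_change U f p q a v : open U -> smooth_fun U f -> U a ->
  cdom (chart p) a -> cdom (chart q) a ->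
  'D_v (f \o cinv (chart q)) (cmap (chart q) a) =
  \sum_(j < n) 'D_v (fun x => cmap (chart p) (cinv (chart q) x) 0 j)
                    (cmap (chart q) a) * pderiv p j f a.
Proof.
move=> oU sf Ua pa qa.
pose G x := cmap (chart p) (cinv (chart q) x).
have od : open (cdom (chart p)) := cdom_open _.
have dG j : differentiable (fun x => G x 0 j) (cmap (chart q) a).
  exact: (smooth_fun_differentiable od (smooth_fun_xcoord p j) pa qa).
have GE : G (cmap (chart q) a) = cmap (chart p) a by rewrite /G cmapK.
have dF : differentiable (f \o cinv (chart p)) (G (cmap (chart q) a)).
  by rewrite GE; exact: (smooth_fun_differentiable oU sf Ua pa).
have [_ E] := derive_chain v dG dF.
transitivity ('D_v ((f \o cinv (chart p)) \o G) (cmap (chart q) a)).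
  apply: near_eq_derive.
  have : \forall x \near cmap (chart q) a, chart_img q (cdom (chart p)) x.
    apply: open_nbhs_nbhs; split; first exact: chart_img_open.
    exact: chart_img_mem.
  by apply: filterS => x /chart_imgP[px _ _] /=; rewrite /G cmapK.
by rewrite E; apply: eq_bigr => j _; rewrite GE.
Qed.

Lemma tderiv_chart U f p q v : open U -> smooth_fun U f -> U q ->
  cdom (chart p) q ->
  tderiv q v f = \sum_(j < n) tderiv q v (xcoord p j) * pderiv p j f q.
Proof. by move=> oU sf Uq pq; apply: chart_change sf Uq pq (chart_mem q). Qed.

(** Smoothness has to be checked in all charts r; there the function is the
    composition of a partial derivative with a change of charts. *)
Lemma smooth_fun_pderiv U f p i : open U -> smooth_fun U f ->
  smooth_fun (U `&` cdom (chart p)) (pderiv p i f).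
Proof.
move=> oU sf r k; pose G x := cmap (chart p) (cinv (chart r) x).
have od : open (cdom (chart p)) := cdom_open _.
have oUp : open (U `&` cdom (chart p)) by exact: openI.
apply: (@Ck_on_comp _ _ _ k _ (chart_img p U)
          ('D_(e i) (f \o cinv (chart p))) G).
- exact: (@chart_img_open r).
- exact: chart_img_open.
- by move=> x /(@chart_imgP r)[[Ux px] _ _]; exact: chart_img_mem.
- by have [_ /(_ i)[]] := sf p k.+1.
- move=> j k'; apply: Ck_onS (smooth_fun_xcoord p j r k').
  by apply: (@chart_imgS r) => q [].
Qed.

Lemma vact_coord_field U f p i q : open U -> smooth_fun U f -> U q ->
  cdom (chart p) q -> vact (coord_field p i) f q = pderiv p i f q.
Proof.
move=> oU sf Uq pq; rewrite /vact /tderiv derive_coord; last first.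
  exact: smooth_fun_differentiable sf Uq (chart_mem q).
rewrite /pderiv (chart_change (e i) oU sf Uq (chart_mem q) pq).
by apply: eq_bigr => j _; rewrite /coord_field mxE.
Qed.

Lemma smooth_coord_field p i : smooth_vfield (cdom (chart p)) (coord_field p i).
Proof.
move=> W f oW Wd sf; have := smooth_fun_pderiv p i oW sf.
rewrite (setIidl Wd); apply: eq_smooth_fun => // q Wq.
by rewrite (vact_coord_field i oW sf Wq (Wd _ Wq)).
Qed.

Lemma pderiv_xcoord p i j q : cdom (chart p) q ->
  pderiv p i (xcoord p j) q = (i == j)%:R.
Proof.
move=> pq; rewrite /pderiv.
have dc : differentiable (fun x : 'rV[R]_n => x 0 j) (cmap (chart p) q).
  exact: differentiable_coord.
transitivity ('D_(e i) (fun x : 'rV[R]_n => x 0 j) (cmap (chart p) q)).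
  apply: near_eq_derive.
  have : \forall x \near cmap (chart p) q, chart_img p (cdom (chart p)) x.
    apply: open_nbhs_nbhs; split; first by apply: chart_img_open; exact: cdom_open.
    exact: chart_img_mem.
  by apply: filterS => x /chart_imgP[_ _] /= {2}<-.
have := @derive_mx R 'rV[R]_n 1 n id (cmap (chart p) q) (e i)
  (@derivable_id _ _ _ _).
rewrite derive_id => /(congr1 (fun A : 'rV[R]_n => A 0 j)).
by rewrite !mxE eqxx /= eq_sym => <-.
Qed.

Lemma coord_field_center p i : coord_field p i p = e i.
Proof.
apply/rowP => j; rewrite !mxE eqxx /= eq_sym.
exact: pderiv_xcoord (chart_mem p).
Qed.

Section AtPoint.
Variables (U : set M) (p : M).
Hypotheses (oU : open U) (Up : U p).

Lemma tderivE f v : smooth_fun U f ->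
  tderiv p v f = \sum_(i < n) v 0 i * pderiv p i f p.
Proof.
move=> sf; apply: derive_coord.
exact: (smooth_fun_differentiable oU sf Up (chart_mem p)).
Qed.

Lemma tderiv_linear f (a : R) v w : smooth_fun U f ->
  tderiv p (a *: v + w) f = a * tderiv p v f + tderiv p w f.
Proof.
move=> sf; have df := smooth_fun_differentiable oU sf Up (chart_mem p).
by rewrite /tderiv deriveDv // deriveZv.
Qed.

Lemma tderivD f g v : smooth_fun U f -> smooth_fun U g ->
  tderiv p v (fun q => f q + g q) = tderiv p v f + tderiv p v g.
Proof.
move=> sf sg.
have df := smooth_fun_differentiable oU sf Up (chart_mem p).
have dg := smooth_fun_differentiable oU sg Up (chart_mem p).
rewrite /tderiv -deriveD //; exact: diff_derivable.
Qed.

Lemma tderivM f g v : smooth_fun U f -> smooth_fun U g ->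
  tderiv p v (fun q => f q * g q) = f p * tderiv p v g + g p * tderiv p v f.
Proof.
move=> sf sg.
have df := smooth_fun_differentiable oU sf Up (chart_mem p).
have dg := smooth_fun_differentiable oU sg Up (chart_mem p).
rewrite /tderiv -[LHS]/('D_v ((f \o cinv (chart p)) * (g \o cinv (chart p))) _).
rewrite deriveM //; try exact: diff_derivable.
by rewrite /= cmapK //; exact: chart_mem.
Qed.

Lemma tderiv_cst (a : R) v : tderiv p v (fun _ => a) = 0.
Proof. exact: derive_cst. Qed.

Lemma tderiv_sum (I : Type) (s : seq I) (F : I -> M -> R) v :
  (forall i, smooth_fun U (F i)) ->
  tderiv p v (fun q => \sum_(i <- s) F i q) = \sum_(i <- s) tderiv p v (F i).
Proof.
move=> sF; elim: s => [|i s IH].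
  rewrite big_nil -[RHS](tderiv_cst 0 v); apply: (tderiv_local v oU Up) => q _.
  by rewrite big_nil.
rewrite big_cons -IH -tderivD //; last exact: smooth_fun_sum.
by apply: (tderiv_local v oU Up) => q _; rewrite big_cons.
Qed.

End AtPoint.

Lemma tderiv_xcoord p v j : tderiv p v (xcoord p j) = v 0 j.
Proof.
rewrite (tderivE (cdom_open _) (chart_mem p)); last exact: smooth_fun_xcoord.
rewrite (bigD1 j) //= pderiv_xcoord ?eqxx ?mulr1; last exact: chart_mem.
rewrite big1 ?addr0 // => i ij.
by rewrite pderiv_xcoord ?(negPf ij) ?mulr0 //; exact: chart_mem.
Qed.

Lemma smooth_vfieldS U W X : W `<=` U -> smooth_vfield U X -> smooth_vfield W X.
Proof. by move=> WU sX A f oA AW; apply: sX => // q /AW /WU. Qed.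

Lemma smooth_vact U X f : open U -> smooth_vfield U X -> smooth_fun U f ->
  smooth_fun U (vact X f).
Proof. by move=> oU sX sf; apply: sX. Qed.

Lemma eq_smooth_vfield U X Y : (forall q, U q -> X q = Y q) ->
  smooth_vfield U X -> smooth_vfield U Y.
Proof.
move=> XY sX W f oW WU sf; have := sX W f oW WU sf.
by apply: eq_smooth_fun => // q /WU Uq; rewrite /vact XY.
Qed.

Lemma smooth_vfield_lin U X Y f : open U -> smooth_fun U f ->
  smooth_vfield U X -> smooth_vfield U Y ->
  smooth_vfield U (fun q => f q *: X q + Y q).
Proof.
move=> oU sf sX sY W g oW WU sg.
have sX' := sX W g oW WU sg; have sY' := sY W g oW WU sg.
have := smooth_funD oW (smooth_funM oW (smooth_funS WU sf) sX') sY'.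
by apply: eq_smooth_fun => // q Wq; rewrite /vact (tderiv_linear oW Wq).
Qed.

Lemma smooth_vfield0 U : smooth_vfield U (fun _ => 0 : 'rV[R]_n).
Proof.
move=> W g oW WU sg; apply: eq_smooth_fun (smooth_fun_cst W 0) => // q Wq.
by rewrite /vact /tderiv derive0.
Qed.

Lemma smooth_vfieldZ U X f : open U -> smooth_fun U f -> smooth_vfield U X ->
  smooth_vfield U (fun q => f q *: X q).
Proof.
move=> oU sf sX; have := smooth_vfield_lin oU sf sX (smooth_vfield0 (U := U)).
apply: eq_smooth_vfield.
by move=> q _; rewrite addr0.
Qed.

Lemma pderivC U f p i j : open U -> smooth_fun U f -> U p ->
  tderiv p (e i) (pderiv p j f) = tderiv p (e j) (pderiv p i f).
Proof.
move=> oU sf Up; set x0 := cmap (chart p) p; set F := f \o cinv (chart p).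
have sF := sf p; have oI := chart_img_open (p := p) oU.
have Ix : chart_img p U x0 by exact: chart_img_mem (chart_mem p).
have E a b : tderiv p (e a) (pderiv p b f) = 'D_(e a) ('D_(e b) F) x0.
  apply: near_eq_derive; have : \forall x \near x0, chart_img p U x.
    exact: open_nbhs_nbhs.
  by apply: filterS => x /chart_imgP[_ _] /= xE; rewrite /pderiv xE.
rewrite !E; have D1 k a : (forall y, chart_img p U y -> derivable F y (e a)) /\
      Ck_on k (chart_img p U) ('D_(e a) F) by have [_] := sF k.+1; exact.
have D2 a b : (forall y, chart_img p U y -> derivable ('D_(e a) F) y (e b)) /\
      Ck_on 0 (chart_img p U) ('D_(e b) ('D_(e a) F)).
  by have [_ [_ ]] := D1 1%N a; exact.
apply: (derive_swap oI Ix).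
- move=> y Iy; have [d1 _] := D1 0%N i; have [d2 _] := D1 0%N j.
  have [d3 _] := D2 j i; have [d4 _] := D2 i j.
  by split; [exact: d2|exact: d1|exact: d3|exact: d4].
- by have [_ c] := D2 j i; exact: Ck_on_continuous c Ix.
- by have [_ c] := D2 i j; exact: Ck_on_continuous c Ix.
Qed.

(** The Leibniz rule for Y f = sum_j Y(x^j) d_j f in the chart chosen at p. *)
Lemma vact_vact_chart U X Y f p : open U -> smooth_vfield U X ->
  smooth_vfield U Y -> smooth_fun U f -> U p ->
  vact X (vact Y f) p =
  \sum_(j < n) (vact X (vact Y (xcoord p j)) p * pderiv p j f p) +
  \sum_(j < n) \sum_(i < n) X p 0 i * Y p 0 j * tderiv p (e i) (pderiv p j f).
Proof.
move=> oU sX sY sf Up; pose W := U `&` cdom (chart p).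
have oW : open W by apply: openI => //; exact: cdom_open.
have Wp : W p by split => //; exact: chart_mem.
have sx j : smooth_fun W (xcoord p j).
  by apply: smooth_funS (smooth_fun_xcoord p j) => q [].
have sYx j : smooth_fun W (vact Y (xcoord p j)) by apply: sY => // q [].
have sd j : smooth_fun W (pderiv p j f) by exact: smooth_fun_pderiv.
rewrite /vact (tderiv_local _ oW Wp (g := fun q =>
   \sum_(j < n) vact Y (xcoord p j) q * pderiv p j f q)); last first.
  by move=> q [Uq pq]; exact: (tderiv_chart _ oU sf Uq pq).
rewrite (tderiv_sum oW Wp); last by move=> j; exact: smooth_funM.
rewrite -big_split /=; apply: eq_bigr => j _.
rewrite (tderivM oW Wp) //; apply: (etrans (addrC _ _)).
rewrite mulrC; congr (_ + _).
rewrite (tderivE oW Wp) // mulr_sumr; apply: eq_bigr => i _.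
by rewrite /vact tderiv_xcoord mulrCA mulrA.
Qed.

Let cancel_common (a b c d : R) : c = d -> a + c - (b + d) = a - b.
Proof. by move=> ->; ring. Qed.

(** The terms with first derivatives of f are the components that define the
    bracket; those with second derivatives are symmetric in X and Y. *)
Lemma vact_lie_bracket U X Y f p : open U -> smooth_vfield U X ->
  smooth_vfield U Y -> smooth_fun U f -> U p ->
  vact (lie_bracket X Y) f p = vact X (vact Y f) p - vact Y (vact X f) p.
Proof.
move=> oU sX sY sf Up.
have E0 := tderivE oU Up (lie_bracket X Y p) sf.
have E1 := vact_vact_chart oU sX sY sf Up.
have E2 := vact_vact_chart oU sY sX sf Up.
apply: (etrans E0); apply: esym; apply: (etrans (f_equal2 (fun a b => a - b) E1 E2)).
apply: (etrans (cancel_common _ _ _)).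
  rewrite exchange_big; apply: eq_bigr => i _; apply: eq_bigr => j _.
  by rewrite (pderivC i j oU sf Up) (mulrC (X p 0 i)).
rewrite -sumrB; apply: eq_bigr => j _.
by rewrite mxE -mulrBl.
Qed.

Lemma smooth_lie_bracket U X Y : open U -> smooth_vfield U X ->
  smooth_vfield U Y -> smooth_vfield U (lie_bracket X Y).
Proof.
move=> oU sX sY W f oW WU sf.
have sX' := smooth_vfieldS WU sX; have sY' := smooth_vfieldS WU sY.
have := smooth_funB oW (smooth_vact oW sX' (smooth_vact oW sY' sf))
                             (smooth_vact oW sY' (smooth_vact oW sX' sf)).
apply: eq_smooth_fun => // q Wq.
exact: (esym (vact_lie_bracket oW sX' sY' sf Wq)).
Qed.

(* The twelve third-order terms of the Jacobi identity, paired off. *)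
Let jacobi_sum (xyz xzy yzx zyx yxz zxy : R) :
  xyz - xzy - (yzx - zyx) + (yzx - yxz - (zxy - xzy))
    + (zxy - zyx - (xyz - yxz)) = 0.
Proof. by ring. Qed.

(** Each component of an iterated bracket at p is its action on a coordinate
    function of the chart chosen at p, where brackets act as commutators. *)
Lemma lie_jacobi U X Y Z p : open U -> smooth_vfield U X ->
  smooth_vfield U Y -> smooth_vfield U Z -> U p ->
  lie_bracket X (lie_bracket Y Z) p + lie_bracket Y (lie_bracket Z X) p
    + lie_bracket Z (lie_bracket X Y) p = 0.
Proof.
move=> oU sX sY sZ Up; pose W := U `&` cdom (chart p).
have oW : open W by apply: openI => //; exact: cdom_open.
have Wp : W p by split => //; exact: chart_mem.
have WU : W `<=` U by move=> q [].
have H A B C j : smooth_vfield U A -> smooth_vfield U B -> smooth_vfield U C ->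
  lie_bracket A (lie_bracket B C) p 0 j =
  vact A (vact B (vact C (xcoord p j))) p - vact A (vact C (vact B (xcoord p j))) p
  - (vact B (vact C (vact A (xcoord p j))) p - vact C (vact B (vact A (xcoord p j))) p).
  move=> sA sB sC.
  have sx : smooth_fun W (xcoord p j).
    by apply: smooth_funS (smooth_fun_xcoord p j) => q [].
  have sA' := smooth_vfieldS WU sA; have sB' := smooth_vfieldS WU sB.
  have sC' := smooth_vfieldS WU sC.
  have sv V1 g : smooth_vfield W V1 -> smooth_fun W g -> smooth_fun W (vact V1 g).
    by move=> s1 s2; exact: smooth_vact.
  rewrite mxE -[fun q : M => cmap (chart p) q 0 j]/(xcoord p j); congr (_ - _).
    rewrite /vact (tderiv_local _ oW Wp (g := fun q =>
      vact B (vact C (xcoord p j)) q - vact C (vact B (xcoord p j)) q)); last first.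
      by move=> q Wq; exact: (vact_lie_bracket oW).
    rewrite (tderivD oW Wp); [|exact/sv/sv|exact/smooth_funN/sv/sv].
    congr (_ + _); rewrite (tderiv_local _ oW Wp (g := fun q =>
      -1 * vact C (vact B (xcoord p j)) q)); last by move=> q _; rewrite mulN1r.
    rewrite (tderivM oW Wp); [|exact: smooth_fun_cst|exact/sv/sv].
    by rewrite tderiv_cst mulr0 addr0 mulN1r.
  by rewrite (vact_lie_bracket oW) //; exact: sv.
have row3 (u v w : 'rV[R]_n) j : (u + v + w) 0 j = u 0 j + v 0 j + w 0 j.
  by rewrite !mxE.
have row0 j : (0 : 'rV[R]_n) 0 j = 0 by rewrite mxE.
apply/rowP => j; apply: (etrans (row3 _ _ _ _)); apply: (etrans _ (esym (row0 j))).
have E1 := H _ _ _ j sX sY sZ; have E2 := H _ _ _ j sY sZ sX.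
have E3 := H _ _ _ j sZ sX sY.
apply: (etrans (f_equal2 +%R (f_equal2 +%R E1 E2) E3)); exact: jacobi_sum.
Qed.

Section VactRules.
Variables (U : set M) (p : M) (X : vfield M).
Hypotheses (oU : open U) (Up : U p).

Lemma vact_local f g : (forall q, U q -> f q = g q) -> vact X f p = vact X g p.
Proof. exact: tderiv_local. Qed.

Lemma vact_cst (a : R) : vact X (fun=> a) p = 0.
Proof. exact: tderiv_cst. Qed.

Lemma vact_const_on f (a : R) : (forall q, U q -> f q = a) -> vact X f p = 0.
Proof. by move=> fa; rewrite (vact_local fa) vact_cst. Qed.

Lemma vactD f g : smooth_fun U f -> smooth_fun U g ->
  vact X (fun q => f q + g q) p = vact X f p + vact X g p.
Proof. exact: tderivD. Qed.

Lemma vactM f g : smooth_fun U f -> smooth_fun U g ->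
  vact X (fun q => f q * g q) p = f p * vact X g p + g p * vact X f p.
Proof. exact: tderivM. Qed.

Lemma vactN f : smooth_fun U f -> vact X (fun q => - f q) p = - vact X f p.
Proof.
move=> sf; have -> : (fun q => - f q) = (fun q => -1 * f q).
  by apply/funext => q; rewrite mulN1r.
by rewrite (vactM (smooth_fun_cst U (-1)) sf) vact_cst mulr0 addr0 mulN1r.
Qed.

End VactRules.

End Manifold.

(** * Conformal fields and solitons in a differential ring *)

Definition derivation (A : comNzRingType) (D : A -> A) : Prop :=
  (forall x y, D (x + y) = D x + D y) /\
  (forall x y, D (x * y) = x * D y + y * D x).

Section DerivationTheory.
Context (A : comNzRingType) (D : A -> A) (dD : derivation D).

Lemma derD x y : D (x + y) = D x + D y. Proof. exact: dD.1. Qed.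
Lemma derM x y : D (x * y) = x * D y + y * D x. Proof. exact: dD.2. Qed.

Lemma der0 : D 0 = 0.
Proof. by apply: (addrI (D 0)); rewrite -derD !addr0. Qed.

Lemma derN x : D (- x) = - D x.
Proof. by apply: (addrI (D x)); rewrite -derD !subrr der0. Qed.

Lemma der1 : D 1 = 0.
Proof.
have := derM 1 1; rewrite !mulr1 !mul1r => E.
by apply: (addrI (D 1)); rewrite -E addr0.
Qed.

Lemma derMn x n : D (x *+ n) = D x *+ n.
Proof. by elim: n => [|n IH]; rewrite ?der0 // !mulrS derD IH. Qed.

Definition derE := (derD, derN, derM, derMn, der1, der0).
End DerivationTheory.

(** Deduces x = y from u = v when x - y is the image of u - v: the functions F
    in use are multiplications by integer constants. *)
Lemma eq_by_diff (A : nmodType) (B : zmodType) (u v : A) (F : A -> B) (x y : B) :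
  u = v -> x - y = F u - F v -> x = y.
Proof. by move=> -> ; rewrite subrr => /subr0_eq. Qed.

(** When 2 D k = k g, the derivative of k^n x is k^n D x up to a multiple of
    k^n x, so a relation multiplied by a power of k can be differentiated without
    spoiling that power. *)
Lemma annihilator_deriv (A : comNzRingType) (D : A -> A) (k g : A) :
  derivation D -> (forall n (x : A), x *+ n.+1 = 0 -> x = 0) ->
  D k *+ 2 = k * g -> forall n x, k ^+ n * x = 0 -> k ^+ n * D x = 0.
Proof.
move=> dD natI Dk n x kx.
have Dkn : D (k ^+ n) *+ 2 = (k ^+ n * g) *+ n.
  elim: n {kx} => [|n IH]; first by rewrite expr0 (der1 dD) mul0rn.
  have -> : D (k ^+ n.+1) *+ 2 = k * (D (k ^+ n) *+ 2) + k ^+ n * (D k *+ 2).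
    by rewrite exprS (derE dD); ring.
  by rewrite IH Dk exprS [in RHS]mulrS; ring.
apply: (natI 1%N); have := congr1 D kx; rewrite !(derE dD) => E.
transitivity ((k ^+ n * D x + x * D (k ^+ n)) *+ 2 - x * (D (k ^+ n) *+ 2)).
  by ring.
have xkg : x * (k ^+ n * g *+ n) = (k ^+ n * x) * g *+ n by ring.
by rewrite E Dkn xkg kx mul0r !mul0rn subr0.
Qed.

Ltac lincomb H := first [ apply: (eq_by_diff (F := fun x => x) H); ring
  | apply: (eq_by_diff (F := fun x => - x) H); ring ].

(** A surface seen through an orthonormal frame: D1 and D2 are its two fields,
    with [D1, D2] = - a D1 - b D2 and Gauss curvature k; (g1, g2) is the gradient
    of a function with Hessian -2k times the metric, (u1, u2) is a conformal
    field with factor 2s, and r measures its rotation. *)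
Section ConformalFrame.
Context (A : comNzRingType) (D1 D2 : A -> A).
Context (d1 : derivation D1) (d2 : derivation D2).
Context (natI : forall n (x : A), x *+ n.+1 = 0 -> x = 0).
Context (a b k g1 g2 s u1 u2 r : A).
Context (D1D2 : forall x, D1 (D2 x) = D2 (D1 x) - a * D1 x - b * D2 x).
Context (D2a : D2 a = k + D1 b + a * a + b * b).
Context (D1k : D1 k *+ 2 = k * g1) (D2k : D2 k *+ 2 = k * g2).
Context (D1g1 : D1 g1 = a * g2 - k - k) (D2g2 : D2 g2 = - b * g1 - k - k).
Context (D1g2 : D1 g2 = - a * g1) (D2g1 : D2 g1 = b * g2).
Context (D1s : D1 s = - g1) (D2s : D2 s = - g2).
Context (D1u1 : D1 u1 = a * u2 + s *+ 2) (D2u2 : D2 u2 = - b * u1 + s *+ 2).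
Context (D1u2 : D1 u2 = r - a * u1) (D2u1 : D2 u1 = b * u2 - r).

Let kP1 := annihilator_deriv d1 natI D1k.
Let kP2 := annihilator_deriv d2 natI D2k.
Let dE := (derE d1, derE d2).
Let gE := (D1g1, D2g2, D2g1, D1g2, D1s, D2s).
Let uE := (D1u1, D2u2, D2u1, D1u2).

(* Integrability of the system for u1, that is the commutator applied to u1. *)
Let D1r : D1 r = - k * u2 + g2 *+ 2.
Proof.
have := D1D2 u1; rewrite !uE !dE !uE !gE D2a => H; lincomb H.
Qed.

(* Likewise for u2. *)
Let D2r : D2 r = k * u1 - g1 *+ 2.
Proof.
have := D1D2 u2; rewrite !uE !dE !uE !gE D2a => H; lincomb H.
Qed.

Let Z := u1 * g1 + u2 * g2 + s *+ 8 + 16%:R.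

(** The integrability condition of the system for r is the variation of k along
    the conformal field; Z appears once 2 dk = k df replaces the gradient of
    k. *)
Lemma conformal_curvature : k * Z = 0.
Proof.
have := D1D2 r; rewrite D2r D1r !dE !gE !uE => H.
have H' : (D1 k *+ 2) * u1 + (D2 k *+ 2) * u2 + (k * s) *+ 8 + k *+ 16 = 0.
  by apply: (eq_by_diff (F := fun x => x *+ 2) H); ring.
by rewrite D1k D2k in H'; rewrite -H' /Z; ring.
Qed.

Let P := g1 * g1 + g2 * g2.
Let Y := (s - 4%:R) * P + k * (s + 2%:R) *+ 8.

(* The derivative of Z along (g1, g2). The rotation r drops out, and the relation
   on Z itself eliminates the field (u1, u2). *)
Let kY0 : k * Y = 0.
Proof.
have E1 : k * D1 Z = 0.
  by rewrite -(expr1 k); apply: kP1; rewrite expr1; exact: conformal_curvature.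
have E2 : k * D2 Z = 0.
  by rewrite -(expr1 k); apply: kP2; rewrite expr1; exact: conformal_curvature.
apply: (natI (n := 1%N)).
transitivity (g1 * (k * D1 Z) + g2 * (k * D2 Z) + k *+ 2 * (k * Z)).
  by rewrite /Z !dE !gE !uE /Y /P; ring.
by rewrite E1 E2 conformal_curvature !mulr0 !addr0.
Qed.

(* The derivative of Y along the first field is a multiple of g1. *)
Let kgP1 : k * (g1 * (P - k *+ 16)) = 0.
Proof.
have E1 : k * D1 Y = 0 by rewrite -(expr1 k); apply: kP1; rewrite expr1; exact: kY0.
apply: (natI (n := 1%N)).
transitivity (- (k * D1 Y) *+ 2 + k * (s + 2%:R) *+ 8 * (D1 k *+ 2 - k * g1)).
  by rewrite /Y /P !dE !gE; ring.
by rewrite E1 D1k subrr oppr0 mul0rn mulr0 addr0.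
Qed.

Let kgP2 : k * (g2 * (P - k *+ 16)) = 0.
Proof.
have E2 : k * D2 Y = 0 by rewrite -(expr1 k); apply: kP2; rewrite expr1; exact: kY0.
apply: (natI (n := 1%N)).
transitivity (- (k * D2 Y) *+ 2 + k * (s + 2%:R) *+ 8 * (D2 k *+ 2 - k * g2)).
  by rewrite /Y /P !dE !gE; ring.
by rewrite E2 D2k subrr oppr0 mul0rn mulr0 addr0.
Qed.

(* Eliminating P between the relation on Y and the previous ones. *)
Let kgs g : k * (g * (P - k *+ 16)) = 0 -> k ^+ 2 * (g * (s - 2%:R)) = 0.
Proof.
move=> kgP; apply: (natI (n := 23)).
transitivity (k * Y * g - (s - 4%:R) * (k * (g * (P - k *+ 16)))).
  by rewrite /Y; ring.
by rewrite kY0 kgP mul0r mulr0 subr0.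
Qed.

(* The divergence of (g1, g2) times (s - 2). *)
Let k2P : k ^+ 2 * (P + k * (s - 2%:R) *+ 4) = 0.
Proof.
have E1 := kgs kgP1; have E2 := kgs kgP2.
have F1 := kP1 E1; have F2 := kP2 E2.
transitivity (- (k ^+ 2 * D1 (g1 * (s - 2%:R)) + k ^+ 2 * D2 (g2 * (s - 2%:R))
    - a * (k ^+ 2 * (g2 * (s - 2%:R))) + b * (k ^+ 2 * (g1 * (s - 2%:R))))).
  by rewrite !dE !gE /P; ring.
by rewrite E1 E2 F1 F2 !mulr0 subr0 !addr0 oppr0.
Qed.

Let k3g g : k * (g * (P - k *+ 16)) = 0 -> k ^+ 3 * g = 0.
Proof.
move=> kgP; apply: (natI (n := 15)).
transitivity (g * (k ^+ 2 * (P + k * (s - 2%:R) *+ 4))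
  - k * (k * (g * (P - k *+ 16))) - k *+ 4 * (k ^+ 2 * (g * (s - 2%:R)))).
  by rewrite /P; ring.
by rewrite k2P kgP kgs // !mulr0 !subr0.
Qed.

(** The vector field k^3 (g1, g2) vanishes, hence so does k^3 times the
    divergence of (g1, g2), which is -4k. *)
Lemma conformal_flat : k ^+ 4 = 0.
Proof.
have E1 := k3g kgP1; have E2 := k3g kgP2.
have F1 := kP1 E1; have F2 := kP2 E2.
apply: (natI (n := 3)).
transitivity (- (k ^+ 3 * D1 g1 + k ^+ 3 * D2 g2 - a * (k ^+ 3 * g2)
                 + b * (k ^+ 3 * g1))).
  by rewrite !gE; ring.
by rewrite E1 E2 F1 F2 !mulr0 subr0 !addr0 oppr0.
Qed.

End ConformalFrame.

(** D1, D2, D3 stand for the frame e1, e2, xi, and a, b, c for the values of om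
    on it; v1, v2, f are the components of the potential field, l and m the
    constants lambda and 2 - lambda - mu. *)
Section WarpedSoliton.
Context (A : comNzRingType) (D1 D2 D3 : A -> A).
Context (d1 : derivation D1) (d2 : derivation D2) (d3 : derivation D3).
Context (natI : forall n (x : A), x *+ n.+1 = 0 -> x = 0).
Context (a b c k v1 v2 f l m : A).

Context (D1D2 : forall x, D1 (D2 x) = D2 (D1 x) - a * D1 x - b * D2 x).
Context (D3D1 : forall x, D3 (D1 x) = D1 (D3 x) - D1 x + c * D2 x).
Context (D3D2 : forall x, D3 (D2 x) = D2 (D3 x) - D2 x - c * D1 x).
Context (D3a : D3 a = D1 c + b * c - a) (D3b : D3 b = D2 c - a * c - b).
Context (D2a : D2 a = k + D1 b + a * a + b * b).

Context (D1l : D1 l = 0) (D2l : D2 l = 0) (D3l : D3 l = 0).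
Context (D1m : D1 m = 0) (D2m : D2 m = 0) (D3m : D3 m = 0).

Context (D3f : D3 f = m).
Context (D3v1 : D3 v1 = v1 + c * v2 - D1 f) (D3v2 : D3 v2 = v2 - c * v1 - D2 f).
Context (D1v1 : D1 v1 = a * v2 - f + 2%:R - l - k).
Context (D2v2 : D2 v2 = - b * v1 - f + 2%:R - l - k).
Context (D1v2 : D1 v2 = - a * v1 - D2 v1 + b * v2).

Let dE := (derE d1, derE d2, derE d3).
(** In the warped product k = e^(-2t) K with K independent of t. *)
Lemma curv_radial : D3 k = - k - k.
Proof.
have := congr1 D3 D2a; rewrite D3D2 D3a !dE D3D1 D3b D3a !dE D1D2 D2a => H.
by apply: (eq_by_diff (F := fun x => - x) H); ring.
Qed.

(** The components of the horizontal Hessian of f come from the derivative along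
    xi of the equations for the horizontal derivatives of v1 and v2, because the
    equations for D3 v1 and D3 v2 bring in the gradient of f. *)
Lemma hess11 : D1 (D1 f) = a * D2 f + m - k - k.
Proof.
have := congr1 D3 D1v1.
rewrite D3D1 D3v1 !dE D3a D3v2 D3f curv_radial D3l D1v2 => H.
by apply: (eq_by_diff (F := fun x => - x) H); ring.
Qed.

Lemma hess22 : D2 (D2 f) = - b * D1 f + m - k - k.
Proof.
have := congr1 D3 D2v2.
rewrite D3D2 D3v2 !dE D3b D3v1 D3f curv_radial D3l D1v2 => H.
by apply: (eq_by_diff (F := fun x => - x) H); ring.
Qed.

Lemma hess21 : D2 (D1 f) = b * D2 f.
Proof.
have := congr1 D3 D1v2.
rewrite D3D1 D3v2 !dE D3D2 D3a D3b D3v1 D3v2 !dE D1D2 D2v2 D1v1 => H.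
apply/eqP; rewrite -subr_eq0; apply/eqP; apply: (natI (n := 1%N)).
by apply: (eq_by_diff (F := fun x => - x) H); ring.
Qed.

Lemma hess12 : D1 (D2 f) = - a * D1 f.
Proof. by rewrite D1D2 hess21; ring. Qed.

(** The Hessian of f scales like e^(-2t) along xi, hence so does m - 2k; as 2k
    has this scaling, the constant m has it too, and vanishes. *)
Lemma radial_slope0 : m = 0.
Proof.
apply: (natI (n := 1%N)).
have := congr1 D3 hess11.
rewrite D3D1 !dE D3D1 D3f D1m D3D2 D3f D2m D3a curv_radial D3m !dE hess12 hess21 hess11 => H.
by apply: (eq_by_diff (F := fun x => - x) H); ring.
Qed.

(** Integrability of the system that prescribes the Hessian of f. *)
Lemma curv_grad1 : D1 k *+ 2 = k * D1 f.
Proof.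
have := D1D2 (D2 f).
rewrite hess22 hess12 !dE !(hess12, hess11, hess21, hess22) D2a D1m => H.
lincomb H.
Qed.

Lemma curv_grad2 : D2 k *+ 2 = k * D2 f.
Proof.
have := D1D2 (D1 f).
rewrite hess11 hess21 !dE !(hess12, hess11, hess21, hess22) D2a D2m => H.
lincomb H.
Qed.

(** The conformal field is 2 V_H - grad f; its rotation is read off from D1. *)
Theorem warped_soliton_flat : k ^+ 4 = 0.
Proof.
apply: (@conformal_flat _ D1 D2 d1 d2 natI a b k (D1 f) (D2 f) (2%:R - l - f)
  (v1 *+ 2 - D1 f) (v2 *+ 2 - D2 f) (D1 (v2 *+ 2 - D2 f) + a * (v1 *+ 2 - D1 f))).
- exact: D1D2.
- exact: D2a.
- exact: curv_grad1.
- exact: curv_grad2.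
- by rewrite hess11 radial_slope0 addr0.
- by rewrite hess22 radial_slope0 addr0.
- exact: hess12.
- exact: hess21.
- by rewrite !dE D1l; ring.
- by rewrite !dE D2l; ring.
- by rewrite !dE D1v1 hess11 radial_slope0; ring.
- by rewrite !dE D2v2 hess22 radial_slope0; ring.
- by rewrite addrK.
- by rewrite !dE D1v2 hess12 hess21; ring.
Qed.

End WarpedSoliton.

(** * The ring of smooth functions on an open set *)

Section SmoothRing.
Context {R : realType} {n : nat} {M : manifold R n}.

(** The point guarantees that the ring of functions is nontrivial. *)
Record popen := POpen {
  popen_set : set M; popen_pt : M;
  popen_open : open popen_set; popen_mem : popen_set popen_pt }.

(** Extension by 0 makes equality in the ring equivalent to equality on O. *)
Record smfun (O : popen) := Smfun {
  smfun_fun :> M -> R;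
  smfun_smooth : smooth_fun (popen_set O) smfun_fun;
  smfun_off : forall q, ~ popen_set O q -> smfun_fun q = 0 }.

Section Ops.
Variable O : popen.
Let oO : open (popen_set O) := popen_open O.

Lemma smfunP (f h : smfun O) : (forall q, popen_set O q -> f q = h q) -> f = h.
Proof.
case: f h => [f sf f0] [h sh h0] /= fh.
have E : f = h.
  by apply/funext => q; have [/fh|nO] := pselect (popen_set O q) => //; rewrite f0 ?h0.
by case: _ / E in sh h0 fh *; congr Smfun; exact: Prop_irrelevance.
Qed.

(** Kept opaque, like smfun_deriv: only the values on O matter, and computations
    in the ring then never unfold the functions. *)
Lemma smfun_exists (f : M -> R) : smooth_fun (popen_set O) f ->
  {F : smfun O | forall q, popen_set O q -> F q = f q}.
Proof.
move=> sf; pose F q := if `[< popen_set O q >] then f q else 0.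
have FE q : popen_set O q -> F q = f q by move=> Oq; rewrite /F asboolT.
have sF : smooth_fun (popen_set O) F by apply: eq_smooth_fun sf => // q /FE.
have F0 q : ~ popen_set O q -> F q = 0 by move=> nO; rewrite /F asboolF.
by exists (Smfun sF F0).
Qed.

Definition smfun0 : smfun O := Smfun (smooth_fun_cst (popen_set O) 0) (fun _ _ => erefl).
Definition smfun1 : smfun O := sval (smfun_exists (smooth_fun_cst (popen_set O) 1)).

Let off_add (f h : smfun O) q : ~ popen_set O q -> f q + h q = 0.
Proof. by move=> nO; rewrite !smfun_off // addr0. Qed.
Let off_opp (f : smfun O) q : ~ popen_set O q -> - f q = 0.
Proof. by move=> nO; rewrite smfun_off // oppr0. Qed.
Let off_mul (f h : smfun O) q : ~ popen_set O q -> f q * h q = 0.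
Proof. by move=> nO; rewrite smfun_off // mul0r. Qed.

Definition smfun_add (f h : smfun O) : smfun O :=
  Smfun (smooth_funD oO (smfun_smooth f) (smfun_smooth h)) (@off_add f h).
Definition smfun_opp (f : smfun O) : smfun O :=
  Smfun (smooth_funN oO (smfun_smooth f)) (@off_opp f).
Definition smfun_mul (f h : smfun O) : smfun O :=
  Smfun (smooth_funM oO (smfun_smooth f) (smfun_smooth h)) (@off_mul f h).

HB.instance Definition _ := gen_eqMixin (smfun O).
HB.instance Definition _ := gen_choiceMixin (smfun O).

Let saddA : associative smfun_add.
Proof. by move=> f h k; apply: smfunP => q _ /=; rewrite addrA. Qed.
Let saddC : commutative smfun_add.
Proof. by move=> f h; apply: smfunP => q _ /=; rewrite addrC. Qed.
Let sadd0 : left_id smfun0 smfun_add.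
Proof. by move=> f; apply: smfunP => q _ /=; rewrite add0r. Qed.
Let saddN : left_inverse smfun0 smfun_opp smfun_add.
Proof. by move=> f; apply: smfunP => q _ /=; rewrite addNr. Qed.

HB.instance Definition _ :=
  GRing.isZmodule.Build (smfun O) saddA saddC sadd0 saddN.

Lemma smfun1E q : popen_set O q -> smfun1 q = 1.
Proof. exact: (svalP (smfun_exists (smooth_fun_cst (popen_set O) 1))). Qed.

Let smulA : associative smfun_mul.
Proof. by move=> f h k; apply: smfunP => q _ /=; rewrite mulrA. Qed.
Let smulC : commutative smfun_mul.
Proof. by move=> f h; apply: smfunP => q _ /=; rewrite mulrC. Qed.
Let smul1 : left_id smfun1 smfun_mul.
Proof. by move=> f; apply: smfunP => q Oq /=; rewrite smfun1E // mul1r. Qed.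
Let smulD : left_distributive smfun_mul smfun_add.
Proof. by move=> f h k; apply: smfunP => q _ /=; rewrite mulrDl. Qed.
Let sone0 : smfun1 != 0 :> smfun O.
Proof.
apply/eqP => /(congr1 (fun f : smfun O => f (popen_pt O))).
rewrite smfun1E; last exact: popen_mem.
by move=> /eqP; rewrite oner_eq0.
Qed.

HB.instance Definition _ :=
  GRing.Zmodule_isComNzRing.Build (smfun O) smulA smulC smul1 smulD sone0.

Lemma smfunDE (f h : smfun O) q : (f + h) q = f q + h q. Proof. by []. Qed.
Lemma smfunNE (f : smfun O) q : (- f) q = - f q. Proof. by []. Qed.
Lemma smfunME (f h : smfun O) q : (f * h) q = f q * h q. Proof. by []. Qed.

Lemma smfunMnE (f : smfun O) m q : (f *+ m) q = f q *+ m.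
Proof. by elim: m => // m IH; rewrite !mulrS smfunDE IH. Qed.

Lemma smfunXE (f : smfun O) m q : popen_set O q -> (f ^+ m) q = f q ^+ m.
Proof.
by move=> Oq; elim: m => [|m IH]; [exact: smfun1E|rewrite !exprS smfunME IH].
Qed.

Lemma smfun_nat (m : nat) q : popen_set O q -> (m%:R : smfun O) q = m%:R.
Proof. by move=> Oq; rewrite smfunMnE; congr (_ *+ m); exact: smfun1E. Qed.

Lemma smfun_torsion_free m (f : smfun O) : f *+ m.+1 = 0 -> f = 0.
Proof.
move=> E; apply: smfunP => q _.
have /eqP := congr1 (fun h : smfun O => h q) E.
by rewrite smfunMnE mulrn_eq0 => /eqP.
Qed.

Lemma smfun_deriv (X : vfield M) : smooth_vfield (popen_set O) X ->
  {D : smfun O -> smfun O | derivation D &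
     forall f q, popen_set O q -> D f q = vact X f q}.
Proof.
move=> sX; pose D f := sval (smfun_exists (smooth_vact oO sX (@smfun_smooth O f))).
have DE f q : popen_set O q -> D f q = vact X f q.
  exact: (svalP (smfun_exists (smooth_vact oO sX (@smfun_smooth O f)))).
exists D => //; split=> f h; apply: smfunP => q Oq.
  rewrite smfunDE !DE //; exact: (vactD X oO Oq (smfun_smooth f) (smfun_smooth h)).
rewrite smfunDE !smfunME !DE //.
exact: (vactM X oO Oq (smfun_smooth f) (smfun_smooth h)).
Qed.

End Ops.
End SmoothRing.

(** * Almost contact metric algebra and the Reeb field *)

Section InnerProduct.
Context {R : realType} {M : manifold R 3}.
Implicit Types (p q : M) (v w : 'rV[R]_3).

Definition ip (g : bilfield M) p v w : R := (v *m g p *m w^T) 0 0.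

Lemma ipDl g p u v w : ip g p (u + v) w = ip g p u w + ip g p v w.
Proof. by rewrite /ip !mulmxDl mxE. Qed.

Lemma ipZl g p (a : R) v w : ip g p (a *: v) w = a * ip g p v w.
Proof. by rewrite /ip -!scalemxAl mxE. Qed.

Lemma ipDr g p u v w : ip g p u (v + w) = ip g p u v + ip g p u w.
Proof. by rewrite /ip [(v + w)^T]linearD mulmxDr mxE. Qed.

Lemma ipZr g p (a : R) v w : ip g p v (a *: w) = a * ip g p v w.
Proof. by rewrite /ip [(a *: w)^T]linearZ /= -scalemxAr mxE. Qed.

Lemma ipNl g p v w : ip g p (- v) w = - ip g p v w.
Proof. by rewrite -scaleN1r ipZl mulN1r. Qed.

Lemma ipNr g p v w : ip g p v (- w) = - ip g p v w.
Proof. by rewrite -scaleN1r ipZr mulN1r. Qed.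

Lemma ip0l g p w : ip g p 0 w = 0.
Proof. by rewrite /ip !mul0mx mxE. Qed.

Lemma ipC g p v w : riemannian g -> ip g p v w = ip g p w v.
Proof.
case=> _ gT _; rewrite /ip -[in RHS](gT p).
have -> : w *m (g p)^T *m v^T = (v *m g p *m w^T)^T.
  by rewrite !trmx_mul trmxK mulmxA.
by rewrite [RHS]mxE.
Qed.

Lemma ip_gt0 g p v : riemannian g -> v != 0 -> 0 < ip g p v v.
Proof. by case=> _ _; exact. Qed.

End InnerProduct.

Section Contact.
Context {R : realType} {M : manifold R 3}.
Context {phi : endofield M} {xi : vfield M} {eta : oneform M} {g : bilfield M}.
Context (acm : almost_contact_metric phi xi eta g).
Implicit Types (p q : M) (v w : 'rV[R]_3).

Let et p v : R := (v *m eta p) 0 0.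
Let gR : riemannian g. Proof. by have [] := acm. Qed.

Let phi2 p v : v *m phi p *m phi p = - v + et p v *: xi p.
Proof. by have [[_ _ _ + _] _ _] := acm; exact. Qed.

Let et_xi p : et p (xi p) = 1.
Proof. by have [[_ _ _ _ +] _ _] := acm; exact. Qed.

Let phi_comp p v w : ip g p (v *m phi p) (w *m phi p) =
  ip g p v w - et p v * et p w.
Proof. by have [_ _] := acm; exact. Qed.

Let etD p v w : et p (v + w) = et p v + et p w.
Proof. by rewrite /et mulmxDl mxE. Qed.
Let etZ p (a : R) v : et p (a *: v) = a * et p v.
Proof. by rewrite /et -scalemxAl mxE. Qed.

(** phi^2 xi = 0, so phi^3 xi = 0 forces phi xi to be a multiple of xi, and a
    nilpotent multiple is zero. *)
Lemma phi_xi p : xi p *m phi p = 0.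
Proof.
have E2 : xi p *m phi p *m phi p = 0 by rewrite phi2 et_xi scale1r addNr.
set a := et p (xi p *m phi p).
have E3 : xi p *m phi p = a *: xi p.
  have := phi2 p (xi p *m phi p); rewrite E2 mul0mx => /eqP.
  by rewrite eq_sym addrC subr_eq0 => /eqP <-.
have a0 : a = 0.
  have := E2; rewrite E3 -scalemxAl E3 scalerA => /(congr1 (et p)).
  rewrite etZ et_xi mulr1 /et mul0mx mxE => /eqP.
  by rewrite mulf_eq0 orbb => /eqP.
by rewrite E3 a0 scale0r.
Qed.

(** The two ways of computing phi^3 v. *)
Lemma eta_phi p v : et p (v *m phi p) = 0.
Proof.
have E : v *m phi p *m phi p *m phi p = - (v *m phi p).
  by rewrite (phi2 p v) mulmxDl mulNmx -scalemxAl phi_xi scaler0 addr0.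
have := phi2 p (v *m phi p); rewrite E => /(congr1 (et p)).
rewrite etD etZ et_xi mulr1 => H.
by apply: (addrI (et p (- (v *m phi p)))); rewrite addr0 -H.
Qed.

Lemma eta_ip p v : (v *m eta p) 0 0 = ip g p v (xi p).
Proof.
have := phi_comp p v (xi p); rewrite phi_xi et_xi mulr1.
rewrite /ip trmx0 mulmx0 [in LHS]mxE => /eqP.
by rewrite eq_sym subr_eq0 => /eqP.
Qed.

Lemma ip_xi_xi p : ip g p (xi p) (xi p) = 1.
Proof. by rewrite -eta_ip; exact: et_xi. Qed.

Lemma ip_phi_xi p v : ip g p (v *m phi p) (xi p) = 0.
Proof. by rewrite -eta_ip; exact: eta_phi. Qed.

Lemma ip_phi_phi p v : ip g p v (xi p) = 0 ->
  ip g p (v *m phi p) (v *m phi p) = ip g p v v.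
Proof. by rewrite -eta_ip => v0; rewrite phi_comp /et v0 mul0r subr0. Qed.

Lemma ip_phi_self p v : ip g p v (xi p) = 0 -> ip g p v (v *m phi p) = 0.
Proof.
rewrite -eta_ip => v0; have := phi_comp p v (v *m phi p).
rewrite eta_phi mulr0 subr0 phi2 /et v0 scale0r addr0 ipNr ipC // => /eqP.
by rewrite eq_sym -addr_eq0 -mulr2n mulrn_eq0 => /eqP.
Qed.

Context {nabla : connection_op M}.
Context (lc : levi_civita g nabla) (km : kenmotsu phi xi eta g nabla).

Lemma smooth_xi U : smooth_vfield U xi.
Proof. by have [[_ sxi _ _ _] _ _] := acm; exact: smooth_vfieldS sxi. Qed.

Lemma nabla0r U X p : open U -> smooth_vfield U X -> U p ->
  nabla X (fun=> 0) p = 0.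
Proof.
move=> oU sX Up; have [aff _ _] := lc.
have := conn_additive aff oU sX (smooth_vfield0 (U := U)) (smooth_vfield0 (U := U)) Up.
rewrite (_ : (fun q : M => 0 + 0) = fun=> 0 :> 'rV[R]_3); last first.
  by apply/funext => q; rewrite addr0.
by move=> /eqP; rewrite -subr_eq subrr eq_sym => /eqP.
Qed.

Lemma metric_rule U X Y Z p : open U -> smooth_vfield U X ->
  smooth_vfield U Y -> smooth_vfield U Z -> U p ->
  vact X (bil_app g Y Z) p =
  ip g p (nabla X Y p) (Z p) + ip g p (Y p) (nabla X Z p).
Proof. by move=> oU sX sY sZ Up; have [_ _ me] := lc; exact: me sZ p Up. Qed.

Lemma torsion_rule U X Y p : open U -> smooth_vfield U X ->
  smooth_vfield U Y -> U p ->
  lie_bracket X Y p = nabla X Y p - nabla Y X p.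
Proof. by move=> oU sX sY Up; have [_ to _] := lc; rewrite (to U). Qed.

(** The Kenmotsu condition on Y = xi reads phi (nabla_X xi) = phi X; applying
    phi again leaves only the component along xi, which vanishes since xi has
    constant length. This is all that the rest uses of the condition. *)
Lemma nabla_xi U X p : open U -> smooth_vfield U X -> U p ->
  nabla X xi p = X p - ip g p (X p) (xi p) *: xi p.
Proof.
move=> oU sX Up; have sxi := @smooth_xi U.
have [_ /(_ U X xi oU sX sxi p Up)] := km.
rewrite /nabla_endo (_ : endo_app phi xi = fun=> 0); last first.
  by apply/funext => q; exact: phi_xi.
rewrite (nabla0r oU sX Up) sub0r /endo_app.
rewrite -[bil_app _ _ _ _]/(ip g p (X p *m phi p) (xi p)) ip_phi_xi scale0r.
rewrite -[form_app _ _ _]/(et p (xi p)) et_xi scale1r sub0r => /oppr_inj E.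
have x0 : ip g p (nabla X xi p) (xi p) = 0.
  have := metric_rule oU sX sxi sxi Up.
  rewrite (_ : bil_app g xi xi = fun=> 1); last first.
    by apply/funext => q; exact: ip_xi_xi.
  rewrite /vact tderiv_cst [X in _ + X]ipC // => /eqP.
  by rewrite eq_sym -mulr2n mulrn_eq0 => /eqP.
have := congr1 (fun u => u *m phi p) E; rewrite !phi2.
rewrite /et !eta_ip x0 scale0r addr0 => /eqP.
by rewrite eqr_oppLR opprD opprK => /eqP.
Qed.

End Contact.

(* Otherwise the comparison of two distinct derivatives unfolds them down to
   limits. *)
#[local] Opaque vact tderiv lie_bracket.

(** * Connection, brackets and curvature in an orthonormal frame *)

Section Frame.
Context {R : realType} {M : manifold R 3}.
Context {phi : endofield M} {xi : vfield M} {eta : oneform M} {g : bilfield M}.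
Context {nabla : connection_op M}.
Context (lc : levi_civita g nabla) (km : kenmotsu phi xi eta g nabla).
Implicit Types (p q : M) (v w : 'rV[R]_3) (X Y Z W : vfield M).

Definition ortho_frame (U : set M) (e1 e2 : vfield M) : Prop :=
  [/\ open U, smooth_vfield U e1, smooth_vfield U e2 &
   forall q, U q -> [/\ ip g q (e1 q) (e1 q) = 1, ip g q (e2 q) (e2 q) = 1,
     ip g q (e1 q) (e2 q) = 0, ip g q (e1 q) (xi q) = 0 &
     ip g q (e2 q) (xi q) = 0]].

Context (U : set M) (e1 e2 : vfield M) (fr : ortho_frame U e1 e2).

Let acm : almost_contact_metric phi xi eta g. Proof. by have [] := km. Qed.
Let gR : riemannian g. Proof. by have [_] := acm. Qed.
Let oU : open U. Proof. by have [] := fr. Qed.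
Let se1 : smooth_vfield U e1. Proof. by have [] := fr. Qed.
Let se2 : smooth_vfield U e2. Proof. by have [] := fr. Qed.
Let sxi : smooth_vfield U xi. Proof. exact: (smooth_xi acm). Qed.
Let sg X Y : smooth_vfield U X -> smooth_vfield U Y -> smooth_fun U (bil_app g X Y).
Proof. by have [sb _ _] := gR; exact: sb. Qed.
Let snabla X Y : smooth_vfield U X -> smooth_vfield U Y -> smooth_vfield U (nabla X Y).
Proof. by have [aff _ _] := lc; exact: (conn_smooth aff). Qed.

Let i11 q : U q -> ip g q (e1 q) (e1 q) = 1. Proof. by have [_ _ _ H] := fr => /H[]. Qed.
Let i22 q : U q -> ip g q (e2 q) (e2 q) = 1. Proof. by have [_ _ _ H] := fr => /H[]. Qed.
Let i12 q : U q -> ip g q (e1 q) (e2 q) = 0. Proof. by have [_ _ _ H] := fr => /H[]. Qed.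
Let i13 q : U q -> ip g q (e1 q) (xi q) = 0. Proof. by have [_ _ _ H] := fr => /H[]. Qed.
Let i23 q : U q -> ip g q (e2 q) (xi q) = 0. Proof. by have [_ _ _ H] := fr => /H[]. Qed.
Let i33 q : ip g q (xi q) (xi q) = 1. Proof. exact: (ip_xi_xi acm). Qed.
Let i21 q : U q -> ip g q (e2 q) (e1 q) = 0. Proof. by move=> /i12; rewrite ipC. Qed.
Let i31 q : U q -> ip g q (xi q) (e1 q) = 0. Proof. by move=> /i13; rewrite ipC. Qed.
Let i32 q : U q -> ip g q (xi q) (e2 q) = 0. Proof. by move=> /i23; rewrite ipC. Qed.

(** Orthonormality says that E and g E^T are inverse to each other, E being the
    matrix with rows e1, e2, xi. *)
Lemma frame_expand q v : U q -> v = ip g q v (e1 q) *: e1 q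
  + ip g q v (e2 q) *: e2 q + ip g q v (xi q) *: xi q.
Proof.
move=> Uq; pose F (i : 'I_3) := [:: e1 q; e2 q; xi q]`_i.
pose E : 'M[R]_3 := \matrix_(i < 3) F i.
have EF i : row i E = F i by rewrite rowK.
have ipE u (i : 'I_3) : (u *m g q *m E^T) 0 i = ip g q u (F i).
  by rewrite /ip !mxE; apply: eq_bigr => j _; rewrite !mxE.
have E1 : E *m (g q *m E^T) = 1%:M.
  apply/matrixP => i j; rewrite mulmxA.
  have -> : (E *m g q *m E^T) i j = ip g q (F i) (F j).
    by rewrite -ipE -EF -!row_mul [RHS]mxE.
  rewrite mxE; move: i j.
  case=> [[|[|[|//]]] Hi]; case=> [[|[|[|//]]] Hj]; rewrite /F /=;
  by rewrite ?i11 ?i22 ?i33 ?i12 ?i13 ?i23 ?i21 ?i31 ?i32.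
have E2 := mulmx1C E1.
rewrite -[LHS]mulmx1 -E2 2!mulmxA mulmx_sum_row !big_ord_recl big_ord0 addr0.
by rewrite !ipE !EF /F /= addrA.
Qed.

Lemma parseval q v w : U q -> ip g q v w =
  ip g q v (e1 q) * ip g q w (e1 q) + ip g q v (e2 q) * ip g q w (e2 q)
  + ip g q v (xi q) * ip g q w (xi q).
Proof.
move=> Uq; rewrite {1}(frame_expand v Uq) !ipDl !ipZl.
by rewrite !(ipC _ w) // .
Qed.

Lemma frame_ext q v w : U q -> ip g q v (e1 q) = ip g q w (e1 q) ->
  ip g q v (e2 q) = ip g q w (e2 q) -> ip g q v (xi q) = ip g q w (xi q) -> v = w.
Proof.
by move=> Uq E1 E2 E3; rewrite (frame_expand v Uq) (frame_expand w Uq) E1 E2 E3.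
Qed.

Definition co1 X := bil_app g X e1.
Definition co2 X := bil_app g X e2.
Definition co3 X := bil_app g X xi.
(** The connection form of the frame: the connection is determined by it, the
    derivatives of xi being known. *)
Definition om X := bil_app g (nabla X e1) e2.

Let sco1 X : smooth_vfield U X -> smooth_fun U (co1 X).
Proof. by move=> sX; exact: sg. Qed.
Let sco2 X : smooth_vfield U X -> smooth_fun U (co2 X).
Proof. by move=> sX; exact: sg. Qed.
Let sco3 X : smooth_vfield U X -> smooth_fun U (co3 X).
Proof. by move=> sX; exact: sg. Qed.
Let som X : smooth_vfield U X -> smooth_fun U (om X).
Proof. by move=> sX; exact: (sg (snabla sX se1) se2). Qed.

(** Differentiation of a constant inner product. *)
Lemma nabla_skew X Y Z (a : R) p : smooth_vfield U X -> smooth_vfield U Y ->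
  smooth_vfield U Z -> U p -> (forall q, U q -> bil_app g Y Z q = a) ->
  ip g p (nabla X Y p) (Z p) = - ip g p (nabla X Z p) (Y p).
Proof.
move=> sX sY sZ Up H; have := metric_rule lc oU sX sY sZ Up.
rewrite (vact_const_on _ oU Up H) (ipC p (Y p) _ gR) => /esym/eqP.
by rewrite addr_eq0 => /eqP.
Qed.

Let self0 (x : R) : x = - x -> x = 0.
Proof. by move=> /eqP; rewrite -addr_eq0 -mulr2n mulrn_eq0 => /eqP. Qed.

Lemma nabla_e1 X p : smooth_vfield U X -> U p ->
  nabla X e1 p = om X p *: e2 p - co1 X p *: xi p.
Proof.
move=> sX Up; apply: (frame_ext Up); rewrite ipDl ipNl !ipZl.
- rewrite i21 // i31 // !mulr0 subr0; apply: self0.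
  exact: (nabla_skew sX se1 se1 Up i11).
- by rewrite i22 // i32 // mulr0 mulr1 subr0.
- rewrite i23 // i33 mulr0 mulr1 sub0r (nabla_skew sX se1 sxi Up i13).
  rewrite (nabla_xi acm lc km oU sX Up) ipDl ipNl ipZl i31 // mulr0 subr0.
  by [].
Qed.

Lemma nabla_e2 X p : smooth_vfield U X -> U p ->
  nabla X e2 p = - om X p *: e1 p - co2 X p *: xi p.
Proof.
move=> sX Up; apply: (frame_ext Up); rewrite ipDl ipNl !ipZl.
- rewrite i11 // i31 // mulr0 mulr1 subr0.
  exact: (nabla_skew sX se2 se1 Up i21).
- rewrite i12 // i32 // !mulr0 subr0; apply: self0.
  exact: (nabla_skew sX se2 se2 Up i22).
- rewrite i13 // i33 mulr0 mulr1 sub0r (nabla_skew sX se2 sxi Up i23).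
  rewrite (nabla_xi acm lc km oU sX Up) ipDl ipNl ipZl i32 // mulr0 subr0.
  by [].
Qed.

Lemma ip_nabla_e1 X p w : smooth_vfield U X -> U p ->
  ip g p (nabla X e1 p) w = om X p * ip g p w (e2 p) - co1 X p * ip g p w (xi p).
Proof.
move=> sX Up; rewrite nabla_e1 // ipDl ipNl !ipZl.
by rewrite (ipC _ (e2 p)) // (ipC _ (xi p)).
Qed.

Lemma ip_nabla_e2 X p w : smooth_vfield U X -> U p ->
  ip g p (nabla X e2 p) w = - om X p * ip g p w (e1 p) - co2 X p * ip g p w (xi p).
Proof.
move=> sX Up; rewrite nabla_e2 // ipDl ipNl !ipZl.
by rewrite (ipC _ (e1 p)) // (ipC _ (xi p)).
Qed.

Lemma ip_nabla_xi X p w : smooth_vfield U X -> U p ->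
  ip g p (nabla X xi p) w = co1 X p * ip g p w (e1 p) + co2 X p * ip g p w (e2 p).
Proof.
move=> sX Up; rewrite (nabla_xi acm lc km oU sX Up) ipDl ipNl ipZl.
rewrite (parseval (X p) w Up) (ipC _ (xi p)) //.
by rewrite -[co1 X p]/(ip g p (X p) (e1 p)) -[co2 X p]/(ip g p (X p) (e2 p)) addrK.
Qed.

(* The exterior derivative of the form dual to Z, computed from nabla Z. *)
Let bracket_co X Y Z p : smooth_vfield U X -> smooth_vfield U Y ->
  smooth_vfield U Z -> U p ->
  ip g p (lie_bracket X Y p) (Z p) =
    vact X (bil_app g Y Z) p - vact Y (bil_app g X Z) p
    - ip g p (nabla X Z p) (Y p) + ip g p (nabla Y Z p) (X p).
Proof.
move=> sX sY sZ Up; rewrite (torsion_rule lc oU sX sY Up) ipDl ipNl.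
rewrite (metric_rule lc oU sX sY sZ Up) (metric_rule lc oU sY sX sZ Up).
rewrite (ipC p (Y p) _ gR) (ipC p (X p) _ gR).
move: (ip g p (nabla X Y p) _) (ip g p (nabla Y X p) _) (ip g p (nabla X Z p) _)
  (ip g p (nabla Y Z p) _) => x1 x2 x3 x4; ring.
Qed.

Lemma bracket_co1 X Y p : smooth_vfield U X -> smooth_vfield U Y -> U p ->
  co1 (lie_bracket X Y) p = vact X (co1 Y) p - vact Y (co1 X) p
    - (om X p * co2 Y p - co1 X p * co3 Y p)
    + (om Y p * co2 X p - co1 Y p * co3 X p).
Proof.
move=> sX sY Up; have := bracket_co sX sY se1 Up.
by rewrite !ip_nabla_e1.
Qed.

Lemma bracket_co2 X Y p : smooth_vfield U X -> smooth_vfield U Y -> U p ->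
  co2 (lie_bracket X Y) p = vact X (co2 Y) p - vact Y (co2 X) p
    - (- om X p * co1 Y p - co2 X p * co3 Y p)
    + (- om Y p * co1 X p - co2 Y p * co3 X p).
Proof.
move=> sX sY Up; have := bracket_co sX sY se2 Up.
by rewrite !ip_nabla_e2.
Qed.

Lemma bracket_co3 X Y p : smooth_vfield U X -> smooth_vfield U Y -> U p ->
  co3 (lie_bracket X Y) p = vact X (co3 Y) p - vact Y (co3 X) p.
Proof.
move=> sX sY Up; have := bracket_co sX sY sxi Up.
rewrite !ip_nabla_xi // => E; apply: (etrans E).
rewrite -[ip g p (Y p) (e1 p)]/(co1 Y p) -[ip g p (Y p) (e2 p)]/(co2 Y p).
rewrite -[ip g p (X p) (e1 p)]/(co1 X p) -[ip g p (X p) (e2 p)]/(co2 X p).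
move: (vact X _ p) (vact Y _ p) => z1 z2; rewrite /co3; ring.
Qed.

Lemma vact_frame X f p : smooth_fun U f -> U p ->
  vact X f p = co1 X p * vact e1 f p + co2 X p * vact e2 f p
               + co3 X p * vact xi f p.
Proof.
move=> sf Up; rewrite -[LHS]/(tderiv p (X p) f) {1}(frame_expand (X p) Up) -addrA.
rewrite !(tderiv_linear oU Up); try exact: sf; rewrite -[in LHS](addr0 (_ *: xi p)).
rewrite (tderiv_linear oU Up); last exact: sf.
have -> : tderiv p 0 f = 0.
  by have := tderivE oU Up 0 sf => ->; rewrite big1 // => i _; rewrite mxE mul0r.
by rewrite addr0 addrA.
Qed.

Lemma nabla0l Y p : smooth_vfield U Y -> U p -> nabla (fun=> 0) Y p = 0.
Proof.
move=> sY Up; have [aff _ _] := lc.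
have s0 := smooth_vfield0 (U := U).
have := conn_linearl aff oU s0 s0 sY (smooth_fun_cst U 1) Up.
rewrite (_ : (fun q : M => 1 *: 0 + 0) = fun=> 0 :> 'rV[R]_3); last first.
  by apply/funext => q; rewrite scaler0 addr0.
by rewrite scale1r => /eqP; rewrite -subr_eq subrr eq_sym => /eqP.
Qed.

(** The linearity axiom of a connection handles f X + X' only, so the expansion
    of X in the frame is built one term at a time. *)
Lemma om_lin X p : smooth_vfield U X -> U p ->
  om X p = om e1 p * co1 X p + om e2 p * co2 X p + om xi p * co3 X p.
Proof.
move=> sX Up; have [aff _ _] := lc.
have s0 := smooth_vfield0 (U := U).
pose X3 : vfield M := fun q => co3 X q *: xi q + (fun=> 0) q.
pose X2 : vfield M := fun q => co2 X q *: e2 q + X3 q.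
pose X1 : vfield M := fun q => co1 X q *: e1 q + X2 q.
have sX3 : smooth_vfield U X3 by apply: smooth_vfield_lin => //; exact: sco3.
have sX2 : smooth_vfield U X2 by apply: smooth_vfield_lin => //; exact: sco2.
have sX1 : smooth_vfield U X1 by apply: smooth_vfield_lin => //; exact: sco1.
have E : nabla X e1 p = nabla X1 e1 p.
  apply: (conn_local aff oU sX se1); last by rewrite inE.
    move=> q; rewrite inE => Uq; rewrite (frame_expand (X q) Uq).
    by rewrite /X1 /X2 /X3 addr0 addrA.
  by [].
rewrite /om /bil_app -!/(ip g p _ _) E.
rewrite (conn_linearl aff oU se1 sX2 se1 (sco1 sX) Up).
rewrite (conn_linearl aff oU se2 sX3 se1 (sco2 sX) Up).
rewrite (conn_linearl aff oU sxi s0 se1 (sco3 sX) Up) nabla0l // addr0.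
by rewrite !ipDl !ipZl; ring.
Qed.

(** Used for fields whose components are known functions on U, which can
    therefore be differentiated. *)
Definition comps X (x1 x2 x3 : M -> R) : Prop :=
  forall q, U q -> [/\ co1 X q = x1 q, co2 X q = x2 q & co3 X q = x3 q].

Lemma comps_e1 : comps e1 (fun=> 1) (fun=> 0) (fun=> 0).
Proof. by move=> q Uq; split; [exact: i11|exact: i12|exact: i13]. Qed.
Lemma comps_e2 : comps e2 (fun=> 0) (fun=> 1) (fun=> 0).
Proof. by move=> q Uq; split; [exact: i21|exact: i22|exact: i23]. Qed.
Lemma comps_xi : comps xi (fun=> 0) (fun=> 0) (fun=> 1).
Proof. by move=> q Uq; split; [exact: i31|exact: i32|exact: i33]. Qed.

Let ip_sum3 p (u v w z : 'rV[R]_3) : u + v + w = 0 ->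
  ip g p u z + ip g p v z + ip g p w z = 0.
Proof. by move=> H; rewrite -!ipDl H ip0l. Qed.

Let co1_sum3 X Y Z p : X p + Y p + Z p = 0 -> co1 X p + co1 Y p + co1 Z p = 0.
Proof. exact: ip_sum3. Qed.

Let co2_sum3 X Y Z p : X p + Y p + Z p = 0 -> co2 X p + co2 Y p + co2 Z p = 0.
Proof. exact: ip_sum3. Qed.

Lemma om_comps X x1 x2 x3 p : smooth_vfield U X -> comps X x1 x2 x3 -> U p ->
  om X p = om e1 p * x1 p + om e2 p * x2 p + om xi p * x3 p.
Proof. by move=> sX cX Up; rewrite om_lin //; have [-> -> ->] := cX p Up. Qed.

Lemma bracket_comps X Y x1 x2 x3 y1 y2 y3 p :
  smooth_vfield U X -> smooth_vfield U Y ->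
  comps X x1 x2 x3 -> comps Y y1 y2 y3 -> U p ->
  [/\ co1 (lie_bracket X Y) p = vact X y1 p - vact Y x1 p
        - (om X p * y2 p - x1 p * y3 p) + (om Y p * x2 p - y1 p * x3 p),
      co2 (lie_bracket X Y) p = vact X y2 p - vact Y x2 p
        - (- om X p * y1 p - x2 p * y3 p) + (- om Y p * x1 p - y2 p * x3 p) &
      co3 (lie_bracket X Y) p = vact X y3 p - vact Y x3 p].
Proof.
move=> sX sY cX cY Up; have [X1 X2 X3] := cX p Up; have [Y1 Y2 Y3] := cY p Up.
have L Z f h : (forall q, U q -> f q = h q) -> vact Z f p = vact Z h p.
  by move=> fh; exact: (vact_local Z oU Up fh).
rewrite bracket_co1 // bracket_co2 // bracket_co3 // X1 X2 X3 Y1 Y2 Y3.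
have Ey1 := L X (co1 Y) y1 (fun q Uq => let: And3 H _ _ := cY q Uq in H).
have Ey2 := L X (co2 Y) y2 (fun q Uq => let: And3 _ H _ := cY q Uq in H).
have Ey3 := L X (co3 Y) y3 (fun q Uq => let: And3 _ _ H := cY q Uq in H).
have Ex1 := L Y (co1 X) x1 (fun q Uq => let: And3 H _ _ := cX q Uq in H).
have Ex2 := L Y (co2 X) x2 (fun q Uq => let: And3 _ H _ := cX q Uq in H).
have Ex3 := L Y (co3 X) x3 (fun q Uq => let: And3 _ _ H := cX q Uq in H).
by rewrite Ey1 Ey2 Ey3 Ex1 Ex2 Ex3.
Qed.

Lemma comps_e1e2 : comps (lie_bracket e1 e2) (fun q => - om e1 q)
  (fun q => - om e2 q) (fun=> 0).
Proof.
move=> q Uq; have [-> -> ->] := bracket_comps se1 se2 comps_e1 comps_e2 Uq.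
by rewrite !vact_cst; split; ring.
Qed.

Lemma comps_e2xi : comps (lie_bracket e2 xi) (om xi) (fun=> 1) (fun=> 0).
Proof.
move=> q Uq; have [-> -> ->] := bracket_comps se2 sxi comps_e2 comps_xi Uq.
by rewrite !vact_cst; split; ring.
Qed.

Lemma comps_xie1 : comps (lie_bracket xi e1) (fun=> - 1) (om xi) (fun=> 0).
Proof.
move=> q Uq; have [-> -> ->] := bracket_comps sxi se1 comps_xi comps_e1 Uq.
by rewrite !vact_cst; split; ring.
Qed.

(* The horizontal components of the Jacobi identity of the frame. They give the
   derivatives along xi of the coefficients of om. *)
Let jacobi_frame p : U p ->
  vact xi (om e1) p = vact e1 (om xi) p + om e2 p * om xi p - om e1 p /\
  vact xi (om e2) p = vact e2 (om xi) p - om e1 p * om xi p - om e2 p.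
Proof.
move=> Up; have := lie_jacobi oU sxi se1 se2 Up.
have s12 := smooth_lie_bracket oU se1 se2.
have s23 := smooth_lie_bracket oU se2 sxi.
have s31 := smooth_lie_bracket oU sxi se1.
have [A1 A2 _] := bracket_comps sxi s12 comps_xi comps_e1e2 Up.
have [B1 B2 _] := bracket_comps se1 s23 comps_e1 comps_e2xi Up.
have [C1 C2 _] := bracket_comps se2 s31 comps_e2 comps_xie1 Up.
rewrite (om_comps s12 comps_e1e2 Up) (om_comps sxi comps_xi Up) in A1 A2.
rewrite (om_comps s23 comps_e2xi Up) (om_comps se1 comps_e1 Up) in B1 B2.
rewrite (om_comps s31 comps_xie1 Up) (om_comps se2 comps_e2 Up) in C1 C2.
have N1 := vactN xi oU Up (som se1); have N2 := vactN xi oU Up (som se2).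
rewrite N1 (vact_cst _ _ 0) in A1; rewrite N2 (vact_cst _ _ 0) in A2.
rewrite (vact_cst p (lie_bracket e2 xi) 1) in B1.
rewrite (vact_cst p e1 1) (vact_cst p (lie_bracket e2 xi) 0) in B2.
rewrite (vact_cst p e2 (-1)) (vact_cst p (lie_bracket xi e1) 0) in C1.
rewrite (vact_cst p (lie_bracket xi e1) 1) in C2.
move=> J.
have J1 := co1_sum3 J; have J2 := co2_sum3 J.
have K1 := etrans (esym (f_equal2 +%R (f_equal2 +%R A1 B1) C1)) J1.
have K2 := etrans (esym (f_equal2 +%R (f_equal2 +%R A2 B2) C2)) J2.
move: (vact xi (om e1) p) (vact xi (om e2) p) (vact e1 (om xi) p) (vact e2 (om xi) p)
  (om e1 p) (om e2 p) (om xi p) K1 K2 {A1 A2 B1 B2 C1 C2 J J1 J2 N1 N2 s12 s23 s31}.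
by move=> *; split; lra.
Qed.

Lemma jacobi1 p : U p ->
  vact xi (om e1) p = vact e1 (om xi) p + om e2 p * om xi p - om e1 p.
Proof. by case/jacobi_frame. Qed.

Lemma jacobi2 p : U p ->
  vact xi (om e2) p = vact e2 (om xi) p - om e1 p * om xi p - om e2 p.
Proof. by case/jacobi_frame. Qed.

(* Only inner products of second covariant derivatives are computed: the metric
   property turns them into derivatives of functions. *)
Let nabla_nabla X Y Z W p : smooth_vfield U X -> smooth_vfield U Y ->
  smooth_vfield U Z -> smooth_vfield U W -> U p ->
  ip g p (nabla X (nabla Y Z) p) (W p) =
  vact X (bil_app g (nabla Y Z) W) p - ip g p (nabla Y Z p) (nabla X W p).
Proof.
move=> sX sY sZ sW Up.
have E := metric_rule lc oU sX (snabla sY sZ) sW Up.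
by apply: (etrans (esym (addrK _ _))); apply: (f_equal2 (fun x y => x - y) (esym E)).
Qed.

Let curv_ip X Y Z W p : smooth_vfield U X -> smooth_vfield U Y ->
  smooth_vfield U Z -> smooth_vfield U W -> U p ->
  ip g p (curvature nabla X Y Z p) (W p) =
  vact X (bil_app g (nabla Y Z) W) p - ip g p (nabla Y Z p) (nabla X W p)
  - (vact Y (bil_app g (nabla X Z) W) p - ip g p (nabla X Z p) (nabla Y W p))
  - ip g p (nabla (lie_bracket X Y) Z p) (W p).
Proof.
move=> sX sY sZ sW Up; rewrite /curvature !ipDl !ipNl.
by congr (_ - _ - _); exact: nabla_nabla.
Qed.

Let skew_comb (r1 r2 x1 x2 n1 n2 y1 y2 m1 m2 l1 l2 u v : R) :
  r1 = x1 - n1 - (y1 - m1) - l1 -> r2 = x2 - n2 - (y2 - m2) - l2 ->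
  x1 + x2 = u -> y1 + y2 = v -> l1 + l2 = u - v -> n1 = m2 -> m1 = n2 ->
  r1 = - r2.
Proof. by move=> -> -> E1 E2 E3 -> ->; lra. Qed.

(** The connection being metric, the symmetrized curvature is the action
    of XY - YX - [X, Y] = 0 on the function g(Z, W). *)
Lemma curvature_skew X Y Z W p : smooth_vfield U X -> smooth_vfield U Y ->
  smooth_vfield U Z -> smooth_vfield U W -> U p ->
  ip g p (curvature nabla X Y Z p) (W p) = - ip g p (curvature nabla X Y W p) (Z p).
Proof.
move=> sX sY sZ sW Up; have sL := smooth_lie_bracket oU sX sY.
have V A B : smooth_vfield U A -> smooth_vfield U B ->
  vact A (bil_app g (nabla B Z) W) p + vact A (bil_app g (nabla B W) Z) p
    = vact A (vact B (bil_app g Z W)) p.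
  move=> sA sB.
  have := vactD A oU Up (sg (snabla sB sZ) sW) (sg (snabla sB sW) sZ).
  move/esym => E; apply: (etrans E); apply: (vact_local A oU Up) => q Uq.
  apply: (etrans _ (esym (metric_rule lc oU sB sZ sW Uq))).
  by congr (_ + _); exact: ipC.
have EL : ip g p (nabla (lie_bracket X Y) Z p) (W p)
    + ip g p (nabla (lie_bracket X Y) W p) (Z p)
  = vact X (vact Y (bil_app g Z W)) p - vact Y (vact X (bil_app g Z W)) p.
  apply: (etrans _ (vact_lie_bracket oU sX sY (sg sZ sW) Up)).
  apply: (etrans _ (esym (metric_rule lc oU sL sZ sW Up))).
  by congr (_ + _); exact: ipC.
exact: (skew_comb (curv_ip sX sY sZ sW Up) (curv_ip sX sY sW sZ Up)
  (V X Y sX sY) (V Y X sY sX) EL (ipC p _ _ gR) (ipC p _ _ gR)).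
Qed.

Let n11 X p : smooth_vfield U X -> U p -> ip g p (nabla X e1 p) (e1 p) = 0.
Proof. by move=> sX Up; rewrite ip_nabla_e1 // i12 // i13 // !mulr0 subr0. Qed.
Let n12 X p : smooth_vfield U X -> U p -> ip g p (nabla X e1 p) (e2 p) = om X p.
Proof. by move=> sX Up; rewrite ip_nabla_e1 // i22 // i23 // mulr0 mulr1 subr0. Qed.
Let n21 X p : smooth_vfield U X -> U p -> ip g p (nabla X e2 p) (e1 p) = - om X p.
Proof. by move=> sX Up; rewrite ip_nabla_e2 // i11 // i13 // mulr0 mulr1 subr0. Qed.
Let n22 X p : smooth_vfield U X -> U p -> ip g p (nabla X e2 p) (e2 p) = 0.
Proof. by move=> sX Up; rewrite ip_nabla_e2 // i21 // i23 // !mulr0 subr0. Qed.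
Let n23 X p : smooth_vfield U X -> U p -> ip g p (nabla X e2 p) (xi p) = - co2 X p.
Proof. by move=> sX Up; rewrite ip_nabla_e2 // i31 // i33 // mulr0 mulr1 sub0r. Qed.
Let n31 X p : smooth_vfield U X -> U p -> ip g p (nabla X xi p) (e1 p) = co1 X p.
Proof. by move=> sX Up; rewrite ip_nabla_xi // i11 // i12 // mulr0 mulr1 addr0. Qed.
Let n32 X p : smooth_vfield U X -> U p -> ip g p (nabla X xi p) (e2 p) = co2 X p.
Proof. by move=> sX Up; rewrite ip_nabla_xi // i21 // i22 // mulr0 mulr1 add0r. Qed.

Let comb_xi (r vx n1 vy m1 l Xy Yx x y x' y' x3 y3 ox oy : R) :
  r = vx - n1 - (vy - m1) - l -> vx = Xy -> vy = Yx ->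
  l = Xy - Yx - (ox * y' - x * y3) + (oy * x' - y * x3) ->
  n1 = y' * ox -> m1 = x' * oy -> r = x3 * y - y3 * x.
Proof. by move=> -> -> -> -> -> ->; ring. Qed.

(* Since nabla xi is the horizontal projection, the curvature on xi is the
   exterior covariant derivative of that projection. *)
Let curv_xi1 X Y p : smooth_vfield U X -> smooth_vfield U Y -> U p ->
  ip g p (curvature nabla X Y xi p) (e1 p) = co3 X p * co1 Y p - co3 Y p * co1 X p.
Proof.
move=> sX sY Up; have sL := smooth_lie_bracket oU sX sY.
have V A B : smooth_vfield U A -> smooth_vfield U B ->
    vact A (bil_app g (nabla B xi) e1) p = vact A (co1 B) p.
  by move=> sA sB; apply: (vact_local A oU Up) => q Uq; exact: n31.
have N A B : smooth_vfield U A -> smooth_vfield U B ->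
    ip g p (nabla B xi p) (nabla A e1 p) = co2 B p * om A p.
  by move=> sA sB; rewrite ip_nabla_xi // n11 // n12 // mulr0 add0r.
apply: (comb_xi (curv_ip sX sY sxi se1 Up) (V X Y sX sY) (V Y X sY sX)
  _ (N X Y sX sY) (N Y X sY sX)).
exact: (etrans (n31 sL Up) (bracket_co1 sX sY Up)).
Qed.

Let curv_xi2 X Y p : smooth_vfield U X -> smooth_vfield U Y -> U p ->
  ip g p (curvature nabla X Y xi p) (e2 p) = co3 X p * co2 Y p - co3 Y p * co2 X p.
Proof.
move=> sX sY Up; have sL := smooth_lie_bracket oU sX sY.
have V A B : smooth_vfield U A -> smooth_vfield U B ->
    vact A (bil_app g (nabla B xi) e2) p = vact A (co2 B) p.
  by move=> sA sB; apply: (vact_local A oU Up) => q Uq; exact: n32.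
have N A B : smooth_vfield U A -> smooth_vfield U B ->
    ip g p (nabla B xi p) (nabla A e2 p) = co1 B p * - om A p.
  by move=> sA sB; rewrite ip_nabla_xi // n21 // n22 // mulr0 addr0.
apply: (comb_xi (curv_ip sX sY sxi se2 Up) (V X Y sX sY) (V Y X sY sX)
  _ (N X Y sX sY) (N Y X sY sX)).
exact: (etrans (n32 sL Up) (bracket_co2 sX sY Up)).
Qed.

(** The Gauss curvature of the leaves orthogonal to xi, equal to 1 plus the
    sectional curvature of the plane of e1 and e2. *)
Definition frame_curv p : R := vact e2 (om e1) p - vact e1 (om e2) p
  - om e1 p * om e1 p - om e2 p * om e2 p.

Let vact_om X Y p : smooth_vfield U X -> smooth_vfield U Y -> U p ->
  vact X (om Y) p =
    om e1 p * vact X (co1 Y) p + co1 Y p * vact X (om e1) p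
  + (om e2 p * vact X (co2 Y) p + co2 Y p * vact X (om e2) p)
  + (om xi p * vact X (co3 Y) p + co3 Y p * vact X (om xi) p).
Proof.
move=> sX sY Up.
have s1 := smooth_funM oU (som se1) (sco1 sY).
have s2 := smooth_funM oU (som se2) (sco2 sY).
have s3 := smooth_funM oU (som sxi) (sco3 sY).
apply: (etrans (vact_local X oU Up (fun q Uq => om_lin sY Uq))).
apply: (etrans (vactD X oU Up (smooth_funD oU s1 s2) s3)).
apply: (f_equal2 +%R _ (vactM X oU Up (som sxi) (sco3 sY))).
apply: (etrans (vactD X oU Up s1 s2)).
exact: (f_equal2 +%R (vactM X oU Up (som se1) (sco1 sY))
                     (vactM X oU Up (som se2) (sco2 sY))).
Qed.

(* Cartan's structure equation in components, with all derivatives as separate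
   variables. The derivatives a3 and b3 along xi are those given by the Jacobi
   identity; they make every term with a component along xi cancel. *)
Let comb_12 (r vx n1 vy m1 l x1 x2 x3 y1 y2 y3 a b c Xa Xb Xc Ya Yb Yc
    a1 a2 a3 b1 b2 b3 c1 c2 c3 Xy1 Xy2 Xy3 Yx1 Yx2 Yx3 l1 l2 l3 ox oy k : R) :
  r = vx - n1 - (vy - m1) - l ->
  vx = a * Xy1 + y1 * Xa + (b * Xy2 + y2 * Xb) + (c * Xy3 + y3 * Xc) ->
  vy = a * Yx1 + x1 * Ya + (b * Yx2 + x2 * Yb) + (c * Yx3 + x3 * Yc) ->
  n1 = y1 * x2 -> m1 = x1 * y2 ->
  l = a * l1 + b * l2 + c * l3 ->
  l1 = Xy1 - Yx1 - (ox * y2 - x1 * y3) + (oy * x2 - y1 * x3) ->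
  l2 = Xy2 - Yx2 - (- ox * y1 - x2 * y3) + (- oy * x1 - y2 * x3) ->
  l3 = Xy3 - Yx3 ->
  ox = a * x1 + b * x2 + c * x3 -> oy = a * y1 + b * y2 + c * y3 ->
  Xa = x1 * a1 + x2 * a2 + x3 * a3 -> Xb = x1 * b1 + x2 * b2 + x3 * b3 ->
  Xc = x1 * c1 + x2 * c2 + x3 * c3 -> Ya = y1 * a1 + y2 * a2 + y3 * a3 ->
  Yb = y1 * b1 + y2 * b2 + y3 * b3 -> Yc = y1 * c1 + y2 * c2 + y3 * c3 ->
  a3 = c1 + b * c - a -> b3 = c2 - a * c - b ->
  k = a2 - b1 - a * a - b * b ->
  r = (1 - k) * (x1 * y2 - x2 * y1).
Proof.
move=> -> -> -> -> -> -> -> -> -> -> -> -> -> -> -> -> -> -> -> ->; ring.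
Qed.

Let curv_12 X Y p : smooth_vfield U X -> smooth_vfield U Y -> U p ->
  ip g p (curvature nabla X Y e1 p) (e2 p) =
  (1 - frame_curv p) * (co1 X p * co2 Y p - co2 X p * co1 Y p).
Proof.
move=> sX sY Up; have sL := smooth_lie_bracket oU sX sY.
have V A B : smooth_vfield U A -> smooth_vfield U B ->
    vact A (bil_app g (nabla B e1) e2) p = vact A (om B) p.
  by move=> sA sB; apply: (vact_local A oU Up) => q Uq; exact: n12.
have N A B : smooth_vfield U A -> smooth_vfield U B ->
    ip g p (nabla B e1 p) (nabla A e2 p) = co1 B p * co2 A p.
  move=> sA sB; rewrite ip_nabla_e1 // n22 // n23 //; ring.
exact: (comb_12 (curv_ip sX sY se1 se2 Up)
  (etrans (V X Y sX sY) (vact_om sX sY Up))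
  (etrans (V Y X sY sX) (vact_om sY sX Up)) (N X Y sX sY) (N Y X sY sX)
  (etrans (n12 sL Up) (om_lin sL Up)) (bracket_co1 sX sY Up)
  (bracket_co2 sX sY Up) (bracket_co3 sX sY Up) (om_lin sX Up) (om_lin sY Up)
  (vact_frame X (som se1) Up) (vact_frame X (som se2) Up)
  (vact_frame X (som sxi) Up) (vact_frame Y (som se1) Up)
  (vact_frame Y (som se2) Up) (vact_frame Y (som sxi) Up)
  (jacobi1 Up) (jacobi2 Up) (erefl (frame_curv p))).
Qed.

Let comb_R (r e12 c1 c2 z1 z2 z3 s : R) (d1 d2 d3 : R) : r = - s ->
  s = d1 * z1 + d2 * z2 + d3 * z3 -> d1 = c1 -> d2 = c2 -> d3 = e12 ->
  r = - (c1 * z1 + c2 * z2 + e12 * z3).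
Proof. by move=> -> -> -> -> ->. Qed.

Let skew0 X Y Z p : smooth_vfield U X -> smooth_vfield U Y ->
  smooth_vfield U Z -> U p -> ip g p (curvature nabla X Y Z p) (Z p) = 0.
Proof. by move=> sX sY sZ Up; apply: self0; exact: curvature_skew. Qed.

(** By skewness R(X, Y) is known from R(X, Y) xi and the one component
    g(R(X, Y) e1, e2). *)
Lemma curvature_frame X Y Z p : smooth_vfield U X -> smooth_vfield U Y ->
  smooth_vfield U Z -> U p ->
  let k := frame_curv p in
  let x1 := co1 X p in let x2 := co2 X p in let x3 := co3 X p in
  let y1 := co1 Y p in let y2 := co2 Y p in let y3 := co3 Y p in
  let z1 := co1 Z p in let z2 := co2 Z p in let z3 := co3 Z p in
  [/\ co1 (curvature nabla X Y Z) p =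
        - ((1 - k) * (x1 * y2 - x2 * y1) * z2) + (x3 * y1 - y3 * x1) * z3,
      co2 (curvature nabla X Y Z) p =
        (1 - k) * (x1 * y2 - x2 * y1) * z1 + (x3 * y2 - y3 * x2) * z3 &
      co3 (curvature nabla X Y Z) p =
        - ((x3 * y1 - y3 * x1) * z1) - (x3 * y2 - y3 * x2) * z2].
Proof.
move=> sX sY sZ Up; cbv zeta.
have K1 := curvature_skew sX sY sZ se1 Up.
have K2 := curvature_skew sX sY sZ se2 Up.
have K3 := curvature_skew sX sY sZ sxi Up.
have P1 := parseval (curvature nabla X Y e1 p) (Z p) Up.
have P2 := parseval (curvature nabla X Y e2 p) (Z p) Up.
have P3 := parseval (curvature nabla X Y xi p) (Z p) Up.
have A13 := curvature_skew sX sY se1 sxi Up.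
have A23 := curvature_skew sX sY se2 sxi Up.
have A21 := curvature_skew sX sY se2 se1 Up.
have B13 := etrans A13 (f_equal -%R (curv_xi1 sX sY Up)).
have B23 := etrans A23 (f_equal -%R (curv_xi2 sX sY Up)).
have B21 := etrans A21 (f_equal -%R (curv_12 sX sY Up)).
split.
- apply: (etrans (@comb_R _ _ _ _ (co1 Z p) (co2 Z p) (co3 Z p) _ _ _ _ K1 P1
    (skew0 sX sY se1 Up) (curv_12 sX sY Up) B13)); ring.
- apply: (etrans (@comb_R _ _ _ _ (co1 Z p) (co2 Z p) (co3 Z p) _ _ _ _ K2 P2
    B21 (skew0 sX sY se2 Up) B23)); ring.
- apply: (etrans (@comb_R _ _ _ _ (co1 Z p) (co2 Z p) (co3 Z p) _ _ _ _ K3 P3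
    (curv_xi1 sX sY Up) (curv_xi2 sX sY Up) (skew0 sX sY sxi Up))); ring.
Qed.

Let comm_comb (l1 u v w x1 x2 x3 d1 d2 d3 : R) : l1 = u - v ->
  l1 = x1 * d1 + x2 * d2 + x3 * d3 -> u = v + (x1 * d1 + x2 * d2 + x3 * d3).
Proof. by move=> -> /eqP; rewrite subr_eq addrC => /eqP. Qed.

Let commutator X Y x1 x2 x3 f p : smooth_vfield U X -> smooth_vfield U Y ->
  comps (lie_bracket X Y) x1 x2 x3 -> smooth_fun U f -> U p ->
  vact X (vact Y f) p = vact Y (vact X f) p
    + (x1 p * vact e1 f p + x2 p * vact e2 f p + x3 p * vact xi f p).
Proof.
move=> sX sY cL sf Up; have [E1 E2 E3] := cL p Up.
have H1 := vact_lie_bracket oU sX sY sf Up.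
have H2 := vact_frame (lie_bracket X Y) sf Up.
have H3 : vact (lie_bracket X Y) f p =
    x1 p * vact e1 f p + x2 p * vact e2 f p + x3 p * vact xi f p.
  apply: (etrans H2); apply: (f_equal2 +%R).
    by apply: (f_equal2 +%R); [exact: (f_equal ( *%R^~ _) E1)|
                               exact: (f_equal ( *%R^~ _) E2)].
  exact: (f_equal ( *%R^~ _) E3).
by have := comm_comb 0 H1 H3.
Qed.

Lemma commutator12 f p : smooth_fun U f -> U p ->
  vact e1 (vact e2 f) p = vact e2 (vact e1 f) p - om e1 p * vact e1 f p
    - om e2 p * vact e2 f p.
Proof.
move=> sf Up; apply: (etrans (commutator se1 se2 comps_e1e2 sf Up)).
move: (vact e2 (vact e1 f) p) (vact e1 f p) (vact e2 f p) (vact xi f p)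
  (om e1 p) (om e2 p) => z1 z2 z3 z4 z5 z6; ring.
Qed.

Lemma commutator31 f p : smooth_fun U f -> U p ->
  vact xi (vact e1 f) p = vact e1 (vact xi f) p - vact e1 f p
    + om xi p * vact e2 f p.
Proof.
move=> sf Up; apply: (etrans (commutator sxi se1 comps_xie1 sf Up)).
move: (vact e1 (vact xi f) p) (vact e1 f p) (vact e2 f p) (vact xi f p)
  (om xi p) => z1 z2 z3 z4 z5; ring.
Qed.

Lemma commutator32 f p : smooth_fun U f -> U p ->
  vact xi (vact e2 f) p = vact e2 (vact xi f) p - vact e2 f p
    - om xi p * vact e1 f p.
Proof.
move=> sf Up; have := commutator se2 sxi comps_e2xi sf Up.
move: (vact e2 (vact xi f) p) (vact xi (vact e2 f) p) (vact e1 f p) (vact e2 f p)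
  (vact xi f p) (om xi p) => z1 z2 z3 z4 z5 z6 ->; ring.
Qed.

End Frame.

(** * Ricci tensor *)

Section Ricci.
Context {R : realType} {M : manifold R 3}.
Context {phi : endofield M} {xi : vfield M} {eta : oneform M} {g : bilfield M}.
Context {nabla : connection_op M}.
Context (lc : levi_civita g nabla) (km : kenmotsu phi xi eta g nabla).
Context (U : set M) (e1 e2 : vfield M) (fr : ortho_frame (xi := xi) (g := g) U e1 e2).

Lemma ortho_frameS (W : set M) : open W -> W `<=` U ->
  ortho_frame (xi := xi) (g := g) W e1 e2.
Proof.
case: fr => oU s1 s2 H oW WU; split => //.
- exact: smooth_vfieldS s1.
- exact: smooth_vfieldS s2.
- by move=> q /WU /H.
Qed.

Lemma sum_ip_coord p (u v : 'rV[R]_3) :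
  \sum_(i < 3) ip g p (delta_mx 0 i) u * v 0 i = ip g p v u.
Proof.
rewrite [in RHS](row_sum_delta v) /ip mulmx_suml mulmx_suml summxE.
apply: eq_bigr => i _; rewrite -scalemxAl -scalemxAl [RHS]mxE.
exact: mulrC.
Qed.

(** The trace defining the Ricci tensor is taken in the coordinate basis at p.
    Each term of the curvature is a product x_l (e_m)_i of a component of d/dx^i
    in the frame and a coordinate of a frame vector, and summing over i gives
    g(e_m, e_l) (sum_ip_coord). *)
Lemma ricci_frame Y Z p : smooth_vfield U Y -> smooth_vfield U Z -> U p ->
  ricci nabla Y Z p =
  (frame_curv (nabla := nabla) (g := g) e1 e2 p - 2)
     * (ip g p (Y p) (e1 p) * ip g p (Z p) (e1 p)
        + ip g p (Y p) (e2 p) * ip g p (Z p) (e2 p))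
  - 2 * (ip g p (Y p) (xi p) * ip g p (Z p) (xi p)).
Proof.
move=> sY sZ Up; have [oU _ _ H] := fr.
pose W := U `&` cdom (chart p).
have oW : open W by apply: openI => //; exact: cdom_open.
have Wp : W p by split => //; exact: chart_mem.
have WU : W `<=` U by move=> q [].
have Wd : W `<=` cdom (chart p) by move=> q [].
have frW := ortho_frameS oW WU.
have sYW := smooth_vfieldS WU sY; have sZW := smooth_vfieldS WU sZ.
rewrite /ricci /mxtrace.
set k := frame_curv _ _ _.
set y1 := ip g p (Y p) (e1 p); set y2 := ip g p (Y p) (e2 p).
set y3 := ip g p (Y p) (xi p); set z1 := ip g p (Z p) (e1 p).
set z2 := ip g p (Z p) (e2 p); set z3 := ip g p (Z p) (xi p).
pose x1 (i : 'I_3) := ip g p (delta_mx 0 i) (e1 p).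
pose x2 (i : 'I_3) := ip g p (delta_mx 0 i) (e2 p).
pose x3 (i : 'I_3) := ip g p (delta_mx 0 i) (xi p).
transitivity (\sum_(i < 3) (
  - ((1 - k) * y2 * z2 + y3 * z3) * (x1 i * e1 p 0 i)
  + (1 - k) * y1 * z2 * (x2 i * e1 p 0 i) + y1 * z3 * (x3 i * e1 p 0 i)
  + (1 - k) * y2 * z1 * (x1 i * e2 p 0 i)
  + - ((1 - k) * y1 * z1 + y3 * z3) * (x2 i * e2 p 0 i)
  + y2 * z3 * (x3 i * e2 p 0 i)
  + y3 * z1 * (x1 i * xi p 0 i) + y3 * z2 * (x2 i * xi p 0 i)
  + - (y1 * z1 + y2 * z2) * (x3 i * xi p 0 i))).
  apply: eq_bigr => i _; rewrite mxE.
  have sX : smooth_vfield W (coord_field p i).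
    exact: (smooth_vfieldS Wd (smooth_coord_field (p := p) i)).
  have [] := curvature_frame lc km frW sX sYW sZW Wp.
  rewrite /co1 /co2 /co3 /bil_app coord_field_center.
  rewrite -!/(ip g p _ _) -/k -/y1 -/y2 -/y3 -/z1 -/z2 -/z3 -/(x1 i) -/(x2 i) -/(x3 i).
  move=> R1 R2 R3.
  rewrite {1}(frame_expand km frW (curvature nabla (coord_field p i) Y Z p) Wp).
  rewrite R1 R2 R3 !mxE.
  by move: (x1 i) (x2 i) (x3 i) (e1 p 0 i) (e2 p 0 i) (xi p 0 i) => *; ring.
rewrite !big_split /= -!mulr_sumr /x1 /x2 /x3 !sum_ip_coord.
have [-> -> i12 i13 i23] := H p Up.
have gR : riemannian g by have [[_ ? _] _] := km.
rewrite (ip_xi_xi (km.1)) i12 (ipC p (e2 p) (e1 p) gR) i12 i13 i23.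
by rewrite (ipC p (xi p) (e1 p) gR) (ipC p (xi p) (e2 p) gR) i13 i23; ring.
Qed.

End Ricci.

(** * The equations of the soliton in the frame *)

(** The brackets of V with the frame (p, q, t below) and the six components of
    the soliton equation, solved for the derivatives of the components of V.
    The component om(V), called o, cancels. *)
Lemma soliton_linear_system (R : realType) (p1 p2 p3 q1 q2 q3 t1 t2 t3 w0 w1 o a b c v1 v2 f k l m
    d11 d12 d1f d21 d22 d2f d31 d32 d3f
    i11 i12 i13 i21 i22 i23 i31 i32 i33 : R) :
  w0 = 0 -> w1 = 0 -> i11 = 1 -> i22 = 1 -> i33 = 1 -> i12 = 0 -> i13 = 0 ->
  i23 = 0 -> i21 = i12 -> i31 = i13 -> i32 = i23 ->
  p1 = w1 - d11 - (o * 0 - v1 * 0) + (a * v2 - 1 * f) ->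
  p2 = w0 - d12 - (- o * 1 - v2 * 0) + (- a * v1 - 0 * f) ->
  p3 = w0 - d1f ->
  q1 = w0 - d21 - (o * 1 - v1 * 0) + (b * v2 - 0 * f) ->
  q2 = w1 - d22 - (- o * 0 - v2 * 0) + (- b * v1 - 1 * f) ->
  q3 = w0 - d2f ->
  t1 = w0 - d31 - (o * 0 - v1 * 1) + (c * v2 - 0 * f) ->
  t2 = w0 - d32 - (- o * 0 - v2 * 1) + (- c * v1 - 0 * f) ->
  t3 = w1 - d3f ->
  2^-1 * (- p1 - p1) + ((k - 2) * (i11 * i11 + i12 * i12) - 2 * (i13 * i13))
    + l * i11 + m * (i13 * i13) = 0 ->
  2^-1 * (- q2 - q2) + ((k - 2) * (i21 * i21 + i22 * i22) - 2 * (i23 * i23))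
    + l * i22 + m * (i23 * i23) = 0 ->
  2^-1 * (- p2 - q1) + ((k - 2) * (i11 * i21 + i12 * i22) - 2 * (i13 * i23))
    + l * i12 + m * (i13 * i23) = 0 ->
  2^-1 * (- p3 - t1) + ((k - 2) * (i11 * i31 + i12 * i32) - 2 * (i13 * i33))
    + l * i13 + m * (i13 * i33) = 0 ->
  2^-1 * (- q3 - t2) + ((k - 2) * (i21 * i31 + i22 * i32) - 2 * (i23 * i33))
    + l * i23 + m * (i23 * i33) = 0 ->
  2^-1 * (- t3 - t3) + ((k - 2) * (i31 * i31 + i32 * i32) - 2 * (i33 * i33))
    + l * i33 + m * (i33 * i33) = 0 ->
  [/\ d3f = 2 - l - m, d31 = v1 + c * v2 - d1f, d32 = v2 - c * v1 - d2f &
   [/\ d11 = a * v2 - f + 2 - l - k, d22 = - b * v1 - f + 2 - l - k &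
       d12 = - a * v1 - d21 + b * v2]].
Proof.
by do 20 (move=> ->); move=> *; split; [lra|lra|lra|split; lra].
Qed.

Section Soliton.
Context {R : realType} {M : manifold R 3}.
Context {phi : endofield M} {xi : vfield M} {eta : oneform M} {g : bilfield M}.
Context {nabla : connection_op M} {V : vfield M} {lambda mu : R}.
Context (lc : levi_civita g nabla) (km : kenmotsu phi xi eta g nabla).
Context (sV : smooth_vfield setT V) (sol : eta_ricci_soliton eta g nabla V lambda mu).
Context (U : set M) (e1 e2 : vfield M).
Context (fr : ortho_frame (xi := xi) (g := g) U e1 e2).

Let oU : open U. Proof. by have [] := fr. Qed.
Let se1 : smooth_vfield U e1. Proof. by have [] := fr. Qed.
Let se2 : smooth_vfield U e2. Proof. by have [] := fr. Qed.
Let acm : almost_contact_metric phi xi eta g. Proof. by have [] := km. Qed.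
Let gR : riemannian g. Proof. by have [_] := acm. Qed.
Let sxi : smooth_vfield U xi. Proof. exact: (smooth_xi acm). Qed.
Let sVU : smooth_vfield U V. Proof. exact: smooth_vfieldS sV. Qed.

Let a := om (g := g) (nabla := nabla) e1 e2 e1.
Let b := om (g := g) (nabla := nabla) e1 e2 e2.
Let c := om (g := g) (nabla := nabla) e1 e2 xi.
Let v1 := co1 (g := g) e1 V.
Let v2 := co2 (g := g) e2 V.
Let f := co3 (xi := xi) (g := g) V.
Let k := frame_curv (nabla := nabla) (g := g) e1 e2.

Let cV : comps (xi := xi) (g := g) U e1 e2 V v1 v2 f.
Proof. by move=> q Uq; split. Qed.

(* Frame fields have constant inner products, so the Lie derivative of g on them
   consists of brackets only. *)
Let lie_ip X Y p : U p -> (exists r : R, forall q, U q -> bil_app g X Y q = r) ->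
  lie_deriv_bil V g X Y p =
  - ip g p (lie_bracket V X p) (Y p) - ip g p (lie_bracket V Y p) (X p).
Proof.
move=> Up [r Hr]; rewrite /lie_deriv_bil (vact_const_on V oU Up Hr) sub0r.
by congr (_ - _); exact: ipC.
Qed.

Let sol_ip X Y p : smooth_vfield U X -> smooth_vfield U Y -> U p ->
  (exists r : R, forall q, U q -> bil_app g X Y q = r) ->
  2^-1 * (- ip g p (lie_bracket V X p) (Y p) - ip g p (lie_bracket V Y p) (X p))
  + ((k p - 2) * (ip g p (X p) (e1 p) * ip g p (Y p) (e1 p)
        + ip g p (X p) (e2 p) * ip g p (Y p) (e2 p))
     - 2 * (ip g p (X p) (xi p) * ip g p (Y p) (xi p)))
  + lambda * ip g p (X p) (Y p)
  + mu * (ip g p (X p) (xi p) * ip g p (Y p) (xi p)) = 0.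
Proof.
move=> sX sY Up Hr; have S := sol oU sX sY Up.
have L := lie_ip Up Hr; have Rc := ricci_frame lc km fr sX sY Up.
have EX : form_app eta X p = ip g p (X p) (xi p) by exact: (eta_ip acm).
have EY : form_app eta Y p = ip g p (Y p) (xi p) by exact: (eta_ip acm).
by rewrite L Rc EX EY in S.
Qed.

Let H11 q : U q -> bil_app g e1 e1 q = 1. Proof. by have [_ _ _ H] := fr => /H[]. Qed.
Let H22 q : U q -> bil_app g e2 e2 q = 1. Proof. by have [_ _ _ H] := fr => /H[]. Qed.
Let H12 q : U q -> bil_app g e1 e2 q = 0. Proof. by have [_ _ _ H] := fr => /H[]. Qed.
Let H13 q : U q -> bil_app g e1 xi q = 0. Proof. by have [_ _ _ H] := fr => /H[]. Qed.
Let H23 q : U q -> bil_app g e2 xi q = 0. Proof. by have [_ _ _ H] := fr => /H[]. Qed.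
Let H33 q : U q -> bil_app g xi xi q = 1. Proof. by move=> _; exact: (ip_xi_xi acm). Qed.

Lemma soliton_equations p : U p ->
  [/\ vact xi f p = 2 - lambda - mu,
      vact xi v1 p = v1 p + c p * v2 p - vact e1 f p,
      vact xi v2 p = v2 p - c p * v1 p - vact e2 f p &
   [/\ vact e1 v1 p = a p * v2 p - f p + 2 - lambda - k p,
       vact e2 v2 p = - b p * v1 p - f p + 2 - lambda - k p &
       vact e1 v2 p = - a p * v1 p - vact e2 v1 p + b p * v2 p]].
Proof.
move=> Up; have [_ _ _ H] := fr; have [i11 i22 i12 i13 i23] := H p Up.
have [P1 P2 P3] := bracket_comps lc km fr sVU se1 cV (comps_e1 fr) Up.
have [Q1 Q2 Q3] := bracket_comps lc km fr sVU se2 cV (comps_e2 km fr) Up.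
have [T1 T2 T3] := bracket_comps lc km fr sVU sxi cV (comps_xi km fr) Up.
exact: (soliton_linear_system (vact_cst p V 0) (vact_cst p V 1) i11 i22
  (ip_xi_xi acm p) i12 i13 i23 (ipC p _ _ gR) (ipC p _ _ gR) (ipC p _ _ gR)
  P1 P2 P3 Q1 Q2 Q3 T1 T2 T3
  (sol_ip se1 se1 Up (ex_intro _ 1 H11)) (sol_ip se2 se2 Up (ex_intro _ 1 H22))
  (sol_ip se1 se2 Up (ex_intro _ 0 H12)) (sol_ip se1 sxi Up (ex_intro _ 0 H13))
  (sol_ip se2 sxi Up (ex_intro _ 0 H23)) (sol_ip sxi sxi Up (ex_intro _ 1 H33))).
Qed.

End Soliton.

(** * Existence of frames and vanishing of the horizontal curvature *)

Section Frames.
Context {R : realType} {M : manifold R 3}.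
Context {phi : endofield M} {xi : vfield M} {eta : oneform M} {g : bilfield M}.
Context (acm : almost_contact_metric phi xi eta g).

Let gR : riemannian g. Proof. by have [_] := acm. Qed.

Lemma open_smooth_pos (U : set M) (f : M -> R) : open U -> smooth_fun U f ->
  open (U `&` [set q | 0 < f q]).
Proof.
move=> oU sf; rewrite openE => q [Uq fq]; rewrite /interior.
have od : open (cdom (chart q)) := cdom_open _.
have dq := chart_mem q.
have c1 : {for q, continuous (cmap (chart q))}.
  have := @cmap_cont _ _ _ (chart q).
  by rewrite (continuous_open_subspace _ od); apply; rewrite inE.
have c2 : {for cmap (chart q) q, continuous (f \o cinv (chart q))}.
  exact: Ck_on_continuous (sf q 0%N) (chart_img_mem Uq dq).
have c := continuous_comp c1 c2.
have fq' : 0 < (f \o cinv (chart q)) (cmap (chart q) q) by rewrite /= cmapK.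
have N1 : \forall y \near q, 0 < (f \o cinv (chart q)) (cmap (chart q) y).
  exact: (cvgr_gt _ c _ fq').
have N2 : \forall y \near q, U y by exact: open_nbhs_nbhs.
have N3 : \forall y \near q, cdom (chart q) y by exact: open_nbhs_nbhs.
apply: filterS3 N1 N2 N3 => y + Uy dy; rewrite /= cmapK //.
Qed.

(** Two distinct coordinate vectors cannot both be multiples of xi. *)
Lemma horizontal_exists p : exists i : 'I_3,
  - ip g p (delta_mx 0 i) (xi p) *: xi p + delta_mx 0 i != 0.
Proof.
apply/not_existsP => H.
have E (i : 'I_3) : delta_mx 0 i = ip g p (delta_mx 0 i) (xi p) *: xi p.
  have /negP := H i; rewrite negbK scaleNr addrC subr_eq0 => /eqP E; exact: E.
have d (i j : 'I_3) : (i == j)%:R = ip g p (delta_mx 0 i) (xi p) * xi p 0 j.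
  have := congr1 (fun v : 'rV[R]_3 => v 0 j) (E i).
  by rewrite !mxE eqxx /= eq_sym.
have d00 := d 0 0; have d01 := d 0 1; have d11 := d 1 1.
rewrite eqxx /= in d00; rewrite eqxx /= in d11; rewrite /= in d01.
move: d01 => /esym/eqP; rewrite mulf_eq0 => /orP[/eqP z|/eqP z].
  by move: d00; rewrite z mul0r => /eqP; rewrite oner_eq0.
by move: d11; rewrite z mulr0 => /eqP; rewrite oner_eq0.
Qed.

(** The first field is the normalized horizontal part of a coordinate field, on
    the open set where it does not vanish; phi rotates it to the second. *)
Lemma ortho_frame_exists p0 : exists (U : set M) (e1 e2 : vfield M),
  U p0 /\ ortho_frame (xi := xi) (g := g) U e1 e2.
Proof.
have [i Hi] := horizontal_exists p0.
pose D := cdom (chart p0); have oD : open D := cdom_open _.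
have [sb _ _] := gR.
have sxi U : smooth_vfield U xi := smooth_xi acm (U := U).
pose h := bil_app g (coord_field p0 i) xi.
have sc : smooth_vfield D (coord_field p0 i) := smooth_coord_field (p := p0) i.
have sh : smooth_fun D h := sb D _ _ oD sc (sxi D).
pose Y : vfield M := fun q => - h q *: xi q + coord_field p0 i q.
have sY : smooth_vfield D Y.
  exact: (smooth_vfield_lin oD (smooth_funN oD sh) (sxi D) sc).
pose N := bil_app g Y Y; have sN : smooth_fun D N := sb D _ _ oD sY sY.
pose U := D `&` [set q | 0 < N q].
have oU : open U by exact: open_smooth_pos.
have UD : U `<=` D by move=> q [].
have Up : U p0.
  split; first exact: chart_mem.
  have Y0 : Y p0 != 0 by rewrite /Y /h /bil_app coord_field_center.
  exact: (ip_gt0 p0 gR Y0).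
pose s q := (Num.sqrt (N q))^-1.
have ss : smooth_fun U s.
  by apply: smooth_fun_inv_sqrt => //; [move=> q []|exact: smooth_funS sN].
pose e1 : vfield M := fun q => s q *: Y q.
have se1 : smooth_vfield U e1.
  by apply: smooth_vfieldZ => //; exact: smooth_vfieldS sY.
exists U, e1, (endo_app phi e1); split; first exact: Up.
have e13 q : ip g q (e1 q) (xi q) = 0.
  by rewrite ipZl ipDl ipZl (ip_xi_xi acm) mulr1 addNr mulr0.
have e11 q : U q -> ip g q (e1 q) (e1 q) = 1.
  case=> _ Nq; rewrite ipZl ipZr -[ip g q (Y q) (Y q)]/(N q) mulrA -expr2 /s.
  by rewrite exprVn sqr_sqrtr ?(ltW Nq) // mulVf // gt_eqF.
split; [exact: oU|exact: se1| |].
  by have [[se _ _ _ _] _ _] := acm; exact: (se U e1 oU se1).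
move=> q Uq; split.
- exact: e11.
- by rewrite (ip_phi_phi acm) // e11.
- exact: (ip_phi_self acm).
- exact: e13.
- exact: (ip_phi_xi acm).
Qed.

End Frames.

Section Flat.
Context {R : realType} {M : manifold R 3}.
Context {phi : endofield M} {xi : vfield M} {eta : oneform M} {g : bilfield M}.
Context {nabla : connection_op M} {V : vfield M} {lambda mu : R}.
Context (lc : levi_civita g nabla) (km : kenmotsu phi xi eta g nabla).
Context (sV : smooth_vfield setT V) (sol : eta_ricci_soliton eta g nabla V lambda mu).

Let curv_split (u v x y : R) : u = u - v - x * x - y * y + v + x * x + y * y.
Proof. by ring. Qed.

(** The frame, the coefficients of om and the components of V on U are an
    instance of warped_soliton_flat, whose hypotheses are checked pointwise. *)
Lemma frame_curv_eq0 (U : set M) (e1 e2 : vfield M) p :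
  ortho_frame (xi := xi) (g := g) U e1 e2 -> U p ->
  frame_curv (nabla := nabla) (g := g) e1 e2 p = 0.
Proof.
move=> fr Up; have [oU se1 se2 _] := fr.
have [acm _] := km; have [_ gR _] := acm; have [sb _ _] := gR.
have [aff _ _] := lc.
have sxi : smooth_vfield U xi := smooth_xi acm (U := U).
have sVU : smooth_vfield U V by exact: smooth_vfieldS sV.
have som X : smooth_vfield U X -> smooth_fun U (om (g := g) (nabla := nabla) e1 e2 X).
  by move=> sX; exact: (sb U _ _ oU (conn_smooth aff oU sX se1) se2).
pose O := POpen oU Up.
have [A HA] := smfun_exists (O := O) (som e1 se1).
have [B HB] := smfun_exists (O := O) (som e2 se2).
have [C HC] := smfun_exists (O := O) (som xi sxi).
have [v1 Hv1] := smfun_exists (O := O) (sb U _ _ oU sVU se1 : smooth_fun (popen_set O) (co1 (g := g) e1 V)).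
have [v2 Hv2] := smfun_exists (O := O) (sb U _ _ oU sVU se2 : smooth_fun (popen_set O) (co2 (g := g) e2 V)).
have [f Hf] := smfun_exists (O := O) (sb U _ _ oU sVU sxi : smooth_fun (popen_set O) (co3 (g := g) (xi := xi) V)).
have sK : smooth_fun U (frame_curv (nabla := nabla) (g := g) e1 e2).
  have s1 := som _ se1; have s2 := som _ se2.
  exact: (smooth_funB oU (smooth_funB oU (smooth_funB oU
    (smooth_vact oU se2 s1) (smooth_vact oU se1 s2)) (smooth_funM oU s1 s1))
    (smooth_funM oU s2 s2)).
have [K HK] := smfun_exists (O := O) sK.
have [l Hl] := smfun_exists (O := O) (smooth_fun_cst U lambda).
have [m Hm] := smfun_exists (O := O) (smooth_fun_cst U (2 - lambda - mu)).
have [D1 d1 HD1] := smfun_deriv (O := O) se1.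
have [D2 d2 HD2] := smfun_deriv (O := O) se2.
have [D3 d3 HD3] := smfun_deriv (O := O) sxi.
have loc X (F : smfun O) h : (forall q, U q -> F q = h q) ->
    forall q, U q -> vact X F q = vact X h q.
  by move=> Fh q Uq; exact: (vact_local X oU Uq Fh).
have E1 (F : smfun O) (h : M -> R) (FH : forall q, U q -> F q = h q)
    q (Uq : U q) : D1 F q = vact e1 h q.
  exact: (etrans (HD1 F q Uq) (loc e1 F h FH q Uq)).
have E2 (F : smfun O) (h : M -> R) (FH : forall q, U q -> F q = h q)
    q (Uq : U q) : D2 F q = vact e2 h q.
  exact: (etrans (HD2 F q Uq) (loc e2 F h FH q Uq)).
have E3 (F : smfun O) (h : M -> R) (FH : forall q, U q -> F q = h q)
    q (Uq : U q) : D3 F q = vact xi h q.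
  exact: (etrans (HD3 F q Uq) (loc xi F h FH q Uq)).
have S q (Uq : U q) := soliton_equations lc km sV sol fr Uq.
have sm (F : smfun O) : smooth_fun U F := smfun_smooth F.
have two q (Uq : U q) : (2%:R : smfun O) q = 2 by exact: (smfun_nat (O := O)).
have K4 : K ^+ 4 = 0.
  apply: (@warped_soliton_flat _ D1 D2 D3 d1 d2 d3 (@smfun_torsion_free _ _ _ O)
    A B C K v1 v2 f l m).
  - move=> x; apply: smfunP => q Uq; rewrite !(smfunDE, smfunNE, smfunME).
    rewrite (E1 _ _ (HD2 x) q Uq) (E2 _ _ (HD1 x) q Uq) (HD1 x q Uq) (HD2 x q Uq).
    by rewrite (HA q Uq) (HB q Uq); exact: (commutator12 lc km fr (sm x) Uq).
  - move=> x; apply: smfunP => q Uq; rewrite !(smfunDE, smfunNE, smfunME).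
    rewrite (E3 _ _ (HD1 x) q Uq) (E1 _ _ (HD3 x) q Uq) (HD1 x q Uq) (HD2 x q Uq).
    by rewrite (HC q Uq); exact: (commutator31 lc km fr (sm x) Uq).
  - move=> x; apply: smfunP => q Uq; rewrite !(smfunDE, smfunNE, smfunME).
    rewrite (E3 _ _ (HD2 x) q Uq) (E2 _ _ (HD3 x) q Uq) (HD1 x q Uq) (HD2 x q Uq).
    by rewrite (HC q Uq); exact: (commutator32 lc km fr (sm x) Uq).
  - apply: smfunP => q Uq; rewrite !(smfunDE, smfunNE, smfunME).
    rewrite (E3 _ _ HA q Uq) (E1 _ _ HC q Uq) (HA q Uq) (HB q Uq) (HC q Uq).
    exact: (jacobi1 lc km fr Uq).
  - apply: smfunP => q Uq; rewrite !(smfunDE, smfunNE, smfunME).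
    rewrite (E3 _ _ HB q Uq) (E2 _ _ HC q Uq) (HA q Uq) (HB q Uq) (HC q Uq).
    exact: (jacobi2 lc km fr Uq).
  - apply: smfunP => q Uq; rewrite !(smfunDE, smfunNE, smfunME).
    rewrite (E2 _ _ HA q Uq) (E1 _ _ HB q Uq) (HA q Uq) (HB q Uq) (HK q Uq).
    exact: curv_split.
  - by apply: smfunP => q Uq; rewrite (E1 _ _ Hl q Uq); exact: vact_cst.
  - by apply: smfunP => q Uq; rewrite (E2 _ _ Hl q Uq); exact: vact_cst.
  - by apply: smfunP => q Uq; rewrite (E3 _ _ Hl q Uq); exact: vact_cst.
  - by apply: smfunP => q Uq; rewrite (E1 _ _ Hm q Uq); exact: vact_cst.
  - by apply: smfunP => q Uq; rewrite (E2 _ _ Hm q Uq); exact: vact_cst.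
  - by apply: smfunP => q Uq; rewrite (E3 _ _ Hm q Uq); exact: vact_cst.
  - apply: smfunP => q Uq; rewrite (E3 _ _ Hf q Uq) (Hm q Uq).
    by have [H _ _ _] := S q Uq; exact: H.
  - apply: smfunP => q Uq; rewrite !(smfunDE, smfunNE, smfunME).
    rewrite (E3 _ _ Hv1 q Uq) (E1 _ _ Hf q Uq) (Hv1 q Uq) (HC q Uq) (Hv2 q Uq).
    by have [_ H _ _] := S q Uq; exact: H.
  - apply: smfunP => q Uq; rewrite !(smfunDE, smfunNE, smfunME).
    rewrite (E3 _ _ Hv2 q Uq) (E2 _ _ Hf q Uq) (Hv1 q Uq) (HC q Uq) (Hv2 q Uq).
    by have [_ _ H _] := S q Uq; exact: H.
  - move: (2%:R : smfun O) two => c2 Hc2.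
    apply: smfunP => q Uq; rewrite !(smfunDE, smfunNE, smfunME) (Hc2 q Uq).
    rewrite (E1 _ _ Hv1 q Uq) (HA q Uq) (Hv2 q Uq) (Hf q Uq) (Hl q Uq) (HK q Uq).
    by have [_ _ _ [H _ _]] := S q Uq; exact: H.
  - move: (2%:R : smfun O) two => c2 Hc2.
    apply: smfunP => q Uq; rewrite !(smfunDE, smfunNE, smfunME) (Hc2 q Uq).
    rewrite (E2 _ _ Hv2 q Uq) (HB q Uq) (Hv1 q Uq) (Hf q Uq) (Hl q Uq) (HK q Uq).
    by have [_ _ _ [_ H _]] := S q Uq; exact: H.
  - apply: smfunP => q Uq; rewrite !(smfunDE, smfunNE, smfunME).
    rewrite (E1 _ _ Hv2 q Uq) (E2 _ _ Hv1 q Uq) (HA q Uq) (HB q Uq) (Hv1 q Uq)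
      (Hv2 q Uq).
    by have [_ _ _ [_ _ H]] := S q Uq; exact: H.
have := congr1 (fun F : smfun O => F p) K4.
by rewrite (smfunXE (O := O)) // (HK p Up) => /eqP; rewrite expf_eq0 => /eqP.
Qed.

Lemma sectional_comb (n x1 x2 x3 y1 y2 y3 r1 r2 r3 k : R) : k = 0 ->
  n = r1 * x1 + r2 * x2 + r3 * x3 ->
  r1 = - ((1 - k) * (x1 * y2 - x2 * y1) * y2) + (x3 * y1 - y3 * x1) * y3 ->
  r2 = (1 - k) * (x1 * y2 - x2 * y1) * y1 + (x3 * y2 - y3 * x2) * y3 ->
  r3 = - ((x3 * y1 - y3 * x1) * y1) - (x3 * y2 - y3 * x2) * y2 ->
  n = - ((x1 * x1 + x2 * x2 + x3 * x3) * (y1 * y1 + y2 * y2 + y3 * y3)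
         - (x1 * y1 + x2 * y2 + x3 * y3) ^+ 2).
Proof. by move=> -> -> -> -> ->; ring. Qed.

(** If the Gram determinant vanishes, so does the length of
    g(w, w) v - g(v, w) w; independence then gives g(w, w) = 0, hence w = 0. *)
Lemma gram_neq0 p (v w : 'rV[R]_3) : row_free (col_mx v w) ->
  ip g p v v * ip g p w w - ip g p v w ^+ 2 != 0.
Proof.
have [[_ gR _] _] := km.
have pos u : ip g p u u = 0 -> u = 0.
  by move=> u0; apply/eqP; apply: contraT => /(ip_gt0 p gR); rewrite u0 ltxx.
move=> rf; apply/eqP => G0.
have comb (s t : R) : s *: v + t *: w = 0 -> s = 0 /\ t = 0.
  move=> E; have : row_mx (s%:M : 'M[R]_1) (t%:M : 'M[R]_1) *m col_mx v w = 0 *m col_mx v w.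
    by rewrite mul_row_col !mul_scalar_mx E mul0mx.
  move=> /(row_free_inj rf) E'.
  have /(congr1 (fun A : 'M[R]_1 => A 0 0)) := congr1 lsubmx E'.
  have /(congr1 (fun A : 'M[R]_1 => A 0 0)) := congr1 rsubmx E'.
  by rewrite row_mxKr row_mxKl !mxE eqxx /= !mulr1n => -> ->.
have z : ip g p w w *: v + - ip g p v w *: w = 0.
  apply: pos; rewrite !ipDl !ipDr !ipZl !ipZr (ipC p w v gR).
  move: G0; move: (ip g p v v) (ip g p w w) (ip g p v w) => x y t G0.
  by transitivity (y * (x * y - t ^+ 2)); [ring|rewrite G0 mulr0].
have [w0 _] := comb _ _ z.
have : 0 *: v + 1 *: w = 0 by rewrite (pos w w0) scale0r scaler0 addr0.
by move=> /comb[_ /eqP]; rewrite oner_eq0.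
Qed.

End Flat.

Theorem corollary3p1 (R : realType) (M : manifold R 3)
    (phi : endofield M) (xi : vfield M) (eta : oneform M) (g : bilfield M)
    (nabla : connection_op M) (V : vfield M) (lambda mu : R) :
  levi_civita g nabla ->
  kenmotsu phi xi eta g nabla ->
  smooth_vfield setT V ->
  eta_ricci_soliton eta g nabla V lambda mu ->
  constant_curvature g nabla (-1).
Proof.
move=> lc km sV sol U0 X Y oU0 sX0 sY0 p U0p rf; have [acm _] := km.
have [U [e1 [e2 [Up fr0]]]] := ortho_frame_exists acm p.
have [oU _ _ _] := fr0; pose U1 := U0 `&` U.
have oU1 : open U1 by exact: openI.
have U1p : U1 p by [].
have fr : ortho_frame (xi := xi) (g := g) U1 e1 e2.
  exact: (ortho_frameS fr0 oU1 (@subIsetr _ U0 U)).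
have sX : smooth_vfield U1 X by apply: smooth_vfieldS sX0 => q [].
have sY : smooth_vfield U1 Y by apply: smooth_vfieldS sY0 => q [].
have k0 := frame_curv_eq0 lc km sV sol fr U1p.
have [R1 R2 R3] := curvature_frame lc km fr sX sY sY U1p.
have PN := parseval km fr (curvature nabla X Y Y p) (X p) U1p.
have N := sectional_comb k0 PN R1 R2 R3.
have G := gram_neq0 km p rf.
rewrite /sectional.
apply: (etrans (f_equal ( *%R^~ _) N)).
apply: (etrans (f_equal ( *%R _) (f_equal GRing.inv (f_equal2 (fun a b => a - b)
  (f_equal2 *%R (parseval km fr (X p) (X p) U1p) (parseval km fr (Y p) (Y p) U1p))
  (f_equal (fun t => t ^+ 2) (parseval km fr (X p) (Y p) U1p)))))).
rewrite (parseval km fr (X p) (X p) U1p) (parseval km fr (Y p) (Y p) U1p)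
  (parseval km fr (X p) (Y p) U1p) in G.
by rewrite mulNr divff.
Qed.
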